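(* Let $Y$ be a compact topological space, $\lambda$ a nontrivial complex line bundle on $Y$, and $\mathbf{PF}$ the projective Fock bundle on $\mathbb{T}\times Y$ constructed from $\lambda$ (see context). Under the isomorphism $H^2(\mathbb{T}\times Y,\underline{\mathbb{T}})\to H^3(\mathbb{T}\times Y,\mathbb{Z})$ associated with the group extension $\mathbb{Z}\to\mathbb{R}\to\mathbb{T}$, the Dixmier-Douady class of $\mathbf{PF}$ is represented by the cup product $\tau=\alpha\smile\beta$, where $\alpha$ is a generator of the group $H^1(\mathbb{T},\mathbb{Z})$ and $\beta\in H^2(Y,\mathbb{Z})$ is the cohomology class of the twisting line bundle $\lambda$ (both pulled back to $\mathbb{T}\times Y$).
   Context: $\mathbb{T}$ is the unit circle; $\underline{\mathbb{T}}$ is the sheaf of continuous $\mathbb{T}$-valued functions. Unitary groups carry the strong operator topology; $PU$ denotes the projective unitary group. Fock space: let $\mathcal{H}=\mathcal{H}^+\oplus\mathcal{H}^-$ be a polarized infinite dimensional complex Hilbert space with orthonormal bases $\{u_i:i\ge 0\}$ of $\mathcal{H}^+$ and $\{u_i:i<0\}$ of $\mathcal{H}^-$. The CAR algebra is the unital $C^*$-algebra generated by $a(f)$, $f\in\mathcal{H}$ (antilinear in $f$), with $\{a(u),a(v)\}=0$, $\{a(u),a(v)^*\}=\langle u,v\rangle \mathbf{1}$. The Fock space $\mathcal{F}$ is its irreducible representation with vacuum $|0\rangle$ such that $a(u)|0\rangle=0=a^*(v)|0\rangle$ for $u\in\mathcal{H}^+$, $v\in\mathcal{H}^-$, with basis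 the vectors $a(u_{i_1})\cdots a(u_{i_k})a^*(u_{j_1})\cdots a^*(u_{j_l})|0\rangle$, $u_{i_x}\in\mathcal{H}^-$, $u_{j_y}\in\mathcal{H}^+$. The charge operator $N$ has such a vector as an eigenvector with eigenvalue $l-k$; $\mathcal{F}=\widehat{\bigoplus}_{k\in\mathbb{Z}}\mathcal{F}^{(k)}$ is the decomposition into charge subspaces. $S$ is the (projective) unitary shift operator with $S|0\rangle=a^*(u_0)|0\rangle$, $Sa(u_k)S^{-1}=a(u_{k+1})$ and $Sa^*(u_k)S^{-1}=a^*(u_{k+1})$ for all $k\in\mathbb{Z}$; it maps $\mathcal{F}^{(k)}$ to $\mathcal{F}^{(k+1)}$ and $SN=(N-1)S$. Fixing $u_0$ gives a unitary lift $\hat S$. Projective Fock bundle: let $\{V_i:1\le i\le n\}$ be an open cover of $Y$ trivializing $\lambda$ with transition functions $h_{ij}:V_{ij}\to\mathbb{T}$. For small $\epsilon>0$ put $\mathbb{T}_+=\{e^{i\phi}:\phi\in(-\epsilon,\pi+\epsilon)\}$, $\mathbb{T}_-=\{e^{i\phi}:\phi\in(\pi-\epsilon,2\pi+\epsilon)\}$; $\mathbb{T}_+\cap\mathbb{T}_-$ is the disjoint union of arcs $\mathbb{T}_{+-}^{(1)}$ around $1$ and $\mathbb{T}_{+-}^{(-1)}$ around $-1$. Cover $\mathbb{T}\times Y$ by $U_i=\mathbb{T}_+\times V_i$, $U_{i+n}=\mathbb{T}_-\times V_i$, $1\le i\le n$. Indices $i$ and $i+n$ refer to the same $V_i$, so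 $h_{i,j+n}=h_{i+n,j+n}=h_{i+n,j}=h_{ij}$. $\mathbf{PF}$ is the projective bundle with fibre the projectivization of $\mathcal{F}$ defined by the $PU(\mathcal{F})$-valued Čech cocycle, for $1\le i,j\le n$: $g_{ij}=h_{ij}^N$, $g_{i+n,j+n}=h_{ij}^N$; over $\mathbb{T}_{+-}^{(-1)}\times V_{ij}$: $g_{i,j+n}=h_{ij}^N$, $g_{j+n,i}=h_{ji}^N$; over $\mathbb{T}_{+-}^{(1)}\times V_{ij}$: $g_{i,j+n}=h_{ij}^N S$, $g_{j+n,i}=S^{-1}h_{ji}^N$. Dixmier-Douady class: with $\hat g_{ij}$ the unitary lifts of $g_{ij}$ given by the same formulas (using $\hat S$), it is the class in $H^2(\mathbb{T}\times Y,\underline{\mathbb{T}})$ of the Čech cocycle $f_{ijk}=\hat g_{ij}\hat g_{jk}\hat g_{ik}^{-1}$, $1\le i,j,k\le 2n$ (equivalently its image in $H^3(\mathbb{T}\times Y,\mathbb{Z})$). *)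

(* Defs.v *)
From HB Require Import structures.
From mathcomp Require Import all_boot all_order all_algebra.
From mathcomp Require Import all_classical all_reals all_analysis.
From mathcomp Require Import complex.
Set Implicit Arguments.
Unset Strict Implicit.
Unset Printing Implicit Defensive.
Import Order.TTheory GRing.Theory Num.Theory.
Import numFieldNormedType.Exports.
Local Open Scope classical_set_scope.
Local Open Scope ring_scope.

(* Packed as a numClosedFieldType so that the generic topology of numeric
   fields is found on the complex numbers. *)
Definition Cx (R : realType) : numClosedFieldType := R[i].

Definition Zd : Type := int.
HB.instance Definition _ := GRing.ComNzRing.copy Zd int.
HB.instance Definition _ := Topological.copy Zd (discrete_topology int).

Lemma Zd_cst_near (T : Type) (f : Zd * Zd -> T) (x : Zd * Zd) :
  \forall y \near x, f y = f x.
Proof.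
exists ([set x.1], [set x.2]) => /=; last by case: x => ? ? [? ?] [/= -> ->].
by split; apply: (@discrete_set1 (discrete_topology int)).
Qed.

Lemma Zd_add_continuous : continuous (fun x : Zd * Zd => x.1 + x.2).
Proof.
move=> x A /nbhs_singleton Ax; apply: filterS (Zd_cst_near (fun y => y.1 + y.2) x).
by move=> y /= ->.
Qed.

Lemma Zd_opp_continuous : continuous (-%R : Zd -> Zd).
Proof.
move=> x A /nbhs_singleton Ax.
have nx : nbhs x [set x] by exact: (@discrete_set1 (discrete_topology int)).
suff : nbhs x (-%R @^-1` A) by [].
by apply: (filterS _ nx) => y ->.
Qed.

HB.instance Definition _ :=
  PreTopologicalNmodule_isTopologicalNmodule.Build Zd Zd_add_continuous.
HB.instance Definition _ :=
  TopologicalNmodule_isTopologicalZmodule.Build Zd Zd_opp_continuous.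

(* The unit circle, with the subspace topology.  Its group law is
   multiplication of complex numbers, but it is written additively (0, +, -)
   so that it can serve as a coefficient group. *)
Definition circle (R : realType) : Type := set_type [set z : Cx R | `|z| = 1].

Section Circle.
Variable R : realType.
Local Notation T := (circle R).
HB.instance Definition _ :=
  Choice.copy T (set_type [set z : Cx R | `|z| = 1]).
HB.instance Definition _ :=
  Topological.copy T (set_type [set z : Cx R | `|z| = 1]).

Definition cval (z : T) : Cx R := set_val z.

Lemma cval_norm (z : T) : `|cval z| = 1.
Proof. exact: (set_valP z). Qed.

Lemma cval_inj : injective cval.
Proof. exact: val_inj. Qed.

Definition mkcircle (z : Cx R) (h : `|z| = 1) : T := exist _ z (mem_set h).

Fact circle0_subproof : `|1 : Cx R| = 1. Proof. exact: normr1. Qed.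
Fact circleN_subproof (z : T) : `|(cval z)^-1| = 1.
Proof. by rewrite normfV cval_norm invr1. Qed.
Fact circleD_subproof (z w : T) : `|cval z * cval w| = 1.
Proof. by rewrite normrM !cval_norm mulr1. Qed.

Definition circle0 : T := mkcircle circle0_subproof.
Definition circleN (z : T) : T := mkcircle (circleN_subproof z).
Definition circleD (z w : T) : T := mkcircle (circleD_subproof z w).

Lemma cval_neq0 (z : T) : cval z != 0.
Proof. by rewrite -normr_eq0 cval_norm oner_eq0. Qed.

Fact circleDA : associative circleD.
Proof. by move=> x y z; apply: cval_inj; exact: mulrA. Qed.
Fact circleDC : commutative circleD.
Proof. by move=> x y; apply: cval_inj; exact: mulrC. Qed.
Fact circle0D : left_id circle0 circleD.
Proof. by move=> x; apply: cval_inj; exact: mul1r. Qed.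
Fact circleND : left_inverse circle0 circleN circleD.
Proof. by move=> x; apply: cval_inj; exact: mulVf (cval_neq0 x). Qed.

HB.instance Definition _ :=
  GRing.isZmodule.Build T circleDA circleDC circle0D circleND.

Lemma cval_continuous : continuous cval.
Proof. exact: (@initial_continuous _ _ set_val). Qed.

Lemma continuous_cval (X : topologicalType) (f : X -> T) :
  continuous (cval \o f) -> continuous f.
Proof. exact: continuous_comp_initial. Qed.

Lemma circle_add_continuous : continuous (fun x : T * T => x.1 + x.2).
Proof.
apply: continuous_cval => x.
rewrite (_ : _ \o _ = (fun x => cval x.1) \* (fun x => cval x.2)) //.
by apply: continuousM; apply: continuous_comp;
  [exact: cvg_fst|exact: cval_continuous|exact: cvg_snd|exact: cval_continuous].
Qed.

Lemma circle_opp_continuous : continuous (-%R : T -> T).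
Proof.
apply: continuous_cval => x.
by apply: continuousV; [exact: cval_neq0|exact: cval_continuous].
Qed.

HB.instance Definition _ :=
  PreTopologicalNmodule_isTopologicalNmodule.Build T circle_add_continuous.
HB.instance Definition _ :=
  TopologicalNmodule_isTopologicalZmodule.Build T circle_opp_continuous.

Fact expi_subproof (t : R) : `|(cos t +i* sin t)%C : Cx R| = 1.
Proof. by rewrite normc_def /= cos2Dsin2 sqrtr1. Qed.

Definition expi (t : R) : T := mkcircle (expi_subproof t).

End Circle.

(* Coefficients are taken in the sheaf of continuous A-valued functions; for the
   discrete group Zd this is the constant sheaf. *)
Section Cech.
Variables (X : topologicalType) (A : topologicalZmodType).

Definition open_cover (I : Type) (U : I -> set X) : Prop :=
  (forall i, open (U i)) /\ (forall x, exists i, U i x).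

Definition overlap (I : Type) (U : I -> set X) p (s : 'I_p.+1 -> I) : set X :=
  [set x | forall k, U (s k) x].

(* The component of a cochain at s is a total function, of which only the
   values on the overlap of s are meaningful. *)
Definition cochain (I : Type) (p : nat) : Type := ('I_p.+1 -> I) -> X -> A.

Definition is_cochain I (U : I -> set X) p (c : cochain I p) : Prop :=
  forall s, {within overlap U s, continuous (c s)}.

Definition cobound I p (c : cochain I p) : cochain I p.+1 :=
  fun s x => \sum_(k < p.+2) c (s \o lift k) x *~ (-1) ^+ k.

Definition is_cocycle I (U : I -> set X) p (c : cochain I p) : Prop :=
  is_cochain U c /\ forall s x, overlap U s x -> cobound c s x = 0.

Definition is_coboundary I (U : I -> set X) p : cochain I p -> Prop :=
  match p with
  | 0 => fun c => forall s x, overlap U s x -> c s x = 0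
  | q.+1 => fun c => exists b : cochain I q, is_cochain U b /\
                       forall s x, overlap U s x -> c s x = cobound b s x
  end.

(* Covers are indexed by the points of X, with x in the open set of index x;
   every open cover has such a refinement, and these covers are directed by
   pointwise inclusion. *)
Definition pointed_cover (U : X -> set X) : Prop :=
  forall x, open (U x) /\ U x x.

Record cocycle (p : nat) := Cocycle {
  ccov : X -> set X;
  cfun : cochain X p;
  ccov_pointed : pointed_cover ccov;
  ccocycle : is_cocycle ccov cfun }.
Arguments ccov [p] c _.
Arguments cfun [p] c _ _.

Definition cohomologous p (c d : cocycle p) : Prop :=
  exists W : X -> set X,
    [/\ pointed_cover W, forall x, W x `<=` ccov c x, forall x, W x `<=` ccov d x &
        is_coboundary W (fun s x => cfun c s x - cfun d s x)].

HB.instance Definition _ p := gen_eqMixin (cocycle p).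
HB.instance Definition _ p := gen_choiceMixin (cocycle p).

Section Ops.
Implicit Types (I J : Type) (p : nat).

Lemma cobound_comp I J (r : J -> I) p (c : cochain I p) s x :
  cobound (fun s => c (r \o s)) s x = cobound c (r \o s) x.
Proof. by []. Qed.

Lemma coboundD I p (c d : cochain I p) s x :
  cobound (fun s x => c s x + d s x) s x = cobound c s x + cobound d s x.
Proof. by rewrite /cobound -big_split; apply: eq_bigr => k _; rewrite mulrzDl. Qed.

Lemma coboundN I p (c : cochain I p) s x :
  cobound (fun s x => - c s x) s x = - cobound c s x.
Proof. by rewrite /cobound -sumrN; apply: eq_bigr => k _; rewrite mulNrz. Qed.

Lemma cobound0 I p s x : cobound (fun (_ : 'I_p.+1 -> I) _ => 0 : A) s x = 0.
Proof. by rewrite /cobound big1// => k _; rewrite mul0rz. Qed.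

Lemma within_continuous_sub (S' S : set X) (f : X -> A) :
  S' `<=` S -> {within S, continuous f} -> {within S', continuous f}.
Proof. exact: continuous_subspaceW. Qed.

Lemma is_cochain_comp I J (U : I -> set X) (V : J -> set X) (r : J -> I) p
    (c : cochain I p) :
  (forall j, V j `<=` U (r j)) -> is_cochain U c ->
  is_cochain V (fun s => c (r \o s)).
Proof.
move=> VU cc s; apply: within_continuous_sub (cc (r \o s)).
by move=> x Vx k; exact/VU/Vx.
Qed.

Lemma is_cochainD I (U : I -> set X) p (c d : cochain I p) :
  is_cochain U c -> is_cochain U d -> is_cochain U (fun s x => c s x + d s x).
Proof.
move=> cc cd s x.
apply: (@continuous_comp (subspace (overlap U s)) _ _
  (fun x => (c s x, d s x)) (fun z : A * A => z.1 + z.2)).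
  by apply: cvg_pair; [exact: cc|exact: cd].
exact: add_continuous.
Qed.

Lemma is_cochainN I (U : I -> set X) p (c : cochain I p) :
  is_cochain U c -> is_cochain U (fun s x => - c s x).
Proof.
move=> cc s x; apply: (@continuous_comp (subspace (overlap U s)) _ _ (c s) -%R); first exact: cc.
exact: opp_continuous.
Qed.

Lemma is_cochain0 I (U : I -> set X) p : is_cochain U (fun (_ : 'I_p.+1 -> I) _ => 0 : A).
Proof. by move=> s x; exact: cvg_cst. Qed.

Lemma is_cocycle_comp I J (U : I -> set X) (V : J -> set X) (r : J -> I) p
    (c : cochain I p) :
  (forall j, V j `<=` U (r j)) -> is_cocycle U c ->
  is_cocycle V (fun s => c (r \o s)).
Proof.
move=> VU [cc c0]; split; first exact: is_cochain_comp cc.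
by move=> s x Vx; rewrite cobound_comp c0// => k; exact/VU/Vx.
Qed.

Lemma is_cocycleD I (U : I -> set X) p (c d : cochain I p) :
  is_cocycle U c -> is_cocycle U d -> is_cocycle U (fun s x => c s x + d s x).
Proof.
move=> [cc c0] [cd d0]; split; first exact: is_cochainD.
by move=> s x Ux; rewrite coboundD c0// d0// addr0.
Qed.

Lemma is_cocycleN I (U : I -> set X) p (c : cochain I p) :
  is_cocycle U c -> is_cocycle U (fun s x => - c s x).
Proof.
move=> [cc c0]; split; first exact: is_cochainN.
by move=> s x Ux; rewrite coboundN c0// oppr0.
Qed.

Lemma is_cocycle0 I (U : I -> set X) p :
  is_cocycle U (fun (_ : 'I_p.+1 -> I) _ => 0 : A).
Proof.
split; first exact: is_cochain0.
by move=> s x _; exact: (@cobound0 I p).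
Qed.

Lemma is_coboundary0 I (U : I -> set X) p (c : cochain I p) :
  (forall s x, overlap U s x -> c s x = 0) -> is_coboundary U c.
Proof.
case: p c => [//|p] c c0; exists (fun _ _ => 0); split; first exact: is_cochain0.
by move=> s x Ux; rewrite c0//; apply/esym; exact: (@cobound0 I p).
Qed.

Lemma is_coboundary_comp I J (U : I -> set X) (V : J -> set X) (r : J -> I) p
    (c : cochain I p) (d : cochain J p) :
  (forall j, V j `<=` U (r j)) ->
  (forall s x, overlap V s x -> d s x = c (r \o s) x) ->
  is_coboundary U c -> is_coboundary V d.
Proof.
move=> VU; have VU' q (s : 'I_q.+1 -> J) : overlap V s `<=` overlap U (r \o s).
  by move=> x Vx k; exact/VU/Vx.
case: p c d => [|p] c d dE.
  by move=> c0 s x Vx; rewrite dE// c0//; exact: VU'.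
move=> [b [cb bE]]; exists (fun s => b (r \o s)); split.
  exact: is_cochain_comp cb.
by move=> s x Vx; rewrite dE// cobound_comp bE//; exact: VU'.
Qed.

Lemma is_coboundaryN I (U : I -> set X) p (c : cochain I p) :
  is_coboundary U c -> is_coboundary U (fun s x => - c s x).
Proof.
case: p c => [|p] c.
  by move=> c0 s x Ux; rewrite c0// oppr0.
move=> [b [cb bE]]; exists (fun s x => - b s x); split; first exact: is_cochainN.
by move=> s x Ux; rewrite coboundN bE.
Qed.

Definition meet_cover (U V : X -> set X) : X -> set X := fun x => U x `&` V x.

Lemma meet_pointed U V :
  pointed_cover U -> pointed_cover V -> pointed_cover (meet_cover U V).
Proof.
move=> hU hV x; have [oU Ux] := hU x; have [oV Vx] := hV x.
by split; [exact: openI|split].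
Qed.

Lemma setT_pointed : pointed_cover (fun=> [set: X]).
Proof. by move=> x; split => //; exact: openT. Qed.

Lemma is_coboundaryD I (U : I -> set X) p (c d : cochain I p) :
  is_coboundary U c -> is_coboundary U d ->
  is_coboundary U (fun s x => c s x + d s x).
Proof.
case: p c d => [|p] c d.
  by move=> c0 d0 s x Ux; rewrite c0// d0// addr0.
move=> [b [cb bE]] [b' [cb' bE']]; exists (fun s x => b s x + b' s x); split.
  exact: is_cochainD.
by move=> s x Ux; rewrite coboundD bE// bE'.
Qed.

Lemma is_coboundaryW (U V : X -> set X) p (c d : cochain X p) :
  (forall x, V x `<=` U x) -> (forall s x, overlap V s x -> d s x = c s x) ->
  is_coboundary U c -> is_coboundary V d.
Proof. by move=> VU dE; exact: (is_coboundary_comp (r := id)). Qed.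

Lemma cohomologousW p (c d : cocycle p) (W : X -> set X) :
  pointed_cover W -> (forall x, W x `<=` ccov c x) ->
  (forall x, W x `<=` ccov d x) ->
  (forall s x, overlap W s x -> cfun c s x = cfun d s x) -> cohomologous c d.
Proof.
move=> pW Wc Wd cd; exists W; split=> //.
by apply: is_coboundary0 => s x /cd ->; rewrite subrr.
Qed.

Lemma cohomologous_refl p (c : cocycle p) : cohomologous c c.
Proof. by apply: (cohomologousW (ccov_pointed c)) => [x z|x z|]. Qed.

Lemma cohomologous_sym p (c d : cocycle p) : cohomologous c d -> cohomologous d c.
Proof.
move=> [W [pW Wc Wd cd]]; exists W; split=> //.
by apply: is_coboundaryW (is_coboundaryN cd) => [x z|s x _ /=] //; rewrite opprB.
Qed.

Lemma cohomologous_trans p (c d e : cocycle p) :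
  cohomologous c d -> cohomologous d e -> cohomologous c e.
Proof.
move=> [W [pW Wc Wd cd]] [W' [pW' W'd W'e de]].
exists (meet_cover W W'); split; first exact: meet_pointed.
- by move=> x z [/Wc].
- by move=> x z [_ /W'e].
have cd' : is_coboundary (meet_cover W W') (fun s x => cfun c s x - cfun d s x).
  by apply: is_coboundaryW cd => // x z [].
have de' : is_coboundary (meet_cover W W') (fun s x => cfun d s x - cfun e s x).
  by apply: is_coboundaryW de => // x z [].
by apply: is_coboundaryW (is_coboundaryD cd' de') => [x z|s x _] //; rewrite addrA subrK.
Qed.

Definition cohomologousb p : rel (cocycle p) :=
  fun c d => `[< cohomologous c d >].

Fact cohomologousb_refl p : reflexive (@cohomologousb p).
Proof. by move=> c; apply/asboolP; exact: cohomologous_refl. Qed.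
Fact cohomologousb_sym p : symmetric (@cohomologousb p).
Proof. by move=> c d; apply/asboolP/asboolP; exact: cohomologous_sym. Qed.
Fact cohomologousb_trans p : transitive (@cohomologousb p).
Proof.
move=> d c e /asboolP cd /asboolP de; apply/asboolP.
exact: cohomologous_trans cd de.
Qed.
Canonical cohomologous_equiv p := EquivRel (@cohomologousb p)
  (@cohomologousb_refl p) (@cohomologousb_sym p) (@cohomologousb_trans p).

Definition cech (p : nat) : Type := {eq_quot (cohomologous_equiv p)}%qT.
HB.instance Definition _ p := Choice.on (cech p).

Definition cech_pi p (c : cocycle p) : cech p := \pi_(cech p)%qT c.

Lemma cech_piP p (c d : cocycle p) :
  cech_pi c = cech_pi d <-> cohomologous c d.
Proof.
by split=> [/eqquotP/asboolP|cd]; last by apply/eqquotP/asboolP.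
Qed.

Lemma cech_reprK p (x : cech p) : cech_pi (repr x) = x.
Proof. exact: reprK. Qed.

Lemma cohomologous_repr p (c : cocycle p) : cohomologous (repr (cech_pi c)) c.
Proof. by apply/cech_piP; rewrite cech_reprK. Qed.


Lemma cocycle_add_subproof p (c d : cocycle p) :
  is_cocycle (meet_cover (ccov c) (ccov d)) (fun s x => cfun c s x + cfun d s x).
Proof.
apply: is_cocycleD.
- by apply: (is_cocycle_comp (r := id)) (ccocycle c) => j x [].
- by apply: (is_cocycle_comp (r := id)) (ccocycle d) => j x [].
Qed.

Definition cocycle_add p (c d : cocycle p) : cocycle p :=
  Cocycle (meet_pointed (ccov_pointed c) (ccov_pointed d))
          (cocycle_add_subproof c d).

Definition cocycle_opp p (c : cocycle p) : cocycle p :=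
  Cocycle (ccov_pointed c) (is_cocycleN (ccocycle c)).

Definition cocycle_zero p : cocycle p :=
  Cocycle setT_pointed (@is_cocycle0 X (fun=> setT) p).

Lemma cocycle_addC p (c d : cocycle p) :
  cohomologous (cocycle_add c d) (cocycle_add d c).
Proof.
apply: (cohomologousW (ccov_pointed (cocycle_add c d))) => [x z|x z []|s x _] //=.
by rewrite addrC.
Qed.

Lemma cocycle_addl p (c c' d : cocycle p) : cohomologous c c' ->
  cohomologous (cocycle_add c d) (cocycle_add c' d).
Proof.
move=> [W [pW Wc Wc' cc']]; exists (meet_cover W (ccov d)); split.
- exact: meet_pointed (ccov_pointed d).
- by move=> x z [/Wc ? ?].
- by move=> x z [/Wc' ? ?].
apply: is_coboundaryW cc' => [x z []//|s x _ /=].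
by rewrite opprD addrACA subrr addr0.
Qed.

Lemma cocycle_addr p (c d d' : cocycle p) : cohomologous d d' ->
  cohomologous (cocycle_add c d) (cocycle_add c d').
Proof.
move=> dd'; apply: (cohomologous_trans (cocycle_addC c d)).
apply: cohomologous_trans (cocycle_addC d' c).
exact: cocycle_addl.
Qed.

Lemma cocycle_oppl p (c c' : cocycle p) : cohomologous c c' ->
  cohomologous (cocycle_opp c) (cocycle_opp c').
Proof.
move=> [W [pW Wc Wc' cc']]; exists W; split=> //.
by apply: is_coboundaryW (is_coboundaryN cc') => [x z|s x _ /=] //; rewrite opprD.
Qed.

Lemma cocycle_addA p (c d e : cocycle p) :
  cohomologous (cocycle_add c (cocycle_add d e)) (cocycle_add (cocycle_add c d) e).
Proof.
apply: (cohomologousW (ccov_pointed (cocycle_add c (cocycle_add d e))))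
  => [x z|x z [? []]|s x _] //=.
by rewrite addrA.
Qed.

Lemma cocycle_add0 p (c : cocycle p) :
  cohomologous (cocycle_add (cocycle_zero p) c) c.
Proof.
apply: (cohomologousW (ccov_pointed c)) => [x z|x z|s x _] //=.
by rewrite add0r.
Qed.

Lemma cocycle_addN p (c : cocycle p) :
  cohomologous (cocycle_add (cocycle_opp c) c) (cocycle_zero p).
Proof.
apply: (cohomologousW (ccov_pointed c)) => [x z|x z|s x _] //=.
by rewrite addNr.
Qed.

Definition cech_add p (x y : cech p) : cech p :=
  cech_pi (cocycle_add (repr x) (repr y)).
Definition cech_opp p (x : cech p) : cech p := cech_pi (cocycle_opp (repr x)).
Definition cech_zero p : cech p := cech_pi (cocycle_zero p).

Lemma cech_add_pi p (c d : cocycle p) :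
  cech_add (cech_pi c) (cech_pi d) = cech_pi (cocycle_add c d).
Proof.
apply/cech_piP.
apply: (@cohomologous_trans _ _ (cocycle_add c (repr (cech_pi d)))).
  exact/cocycle_addl/cohomologous_repr.
exact/cocycle_addr/cohomologous_repr.
Qed.

Lemma cech_opp_pi p (c : cocycle p) : cech_opp (cech_pi c) = cech_pi (cocycle_opp c).
Proof. exact/cech_piP/cocycle_oppl/cohomologous_repr. Qed.

Fact cech_addA p : associative (@cech_add p).
Proof.
move=> x y z; rewrite -[x]cech_reprK -[y]cech_reprK -[z]cech_reprK !cech_add_pi.
exact/cech_piP/cocycle_addA.
Qed.
Fact cech_addC p : commutative (@cech_add p).
Proof. by move=> x y; exact/cech_piP/cocycle_addC. Qed.
Fact cech_add0 p : left_id (@cech_zero p) (@cech_add p).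
Proof.
by move=> x; rewrite -[x]cech_reprK cech_add_pi; exact/cech_piP/cocycle_add0.
Qed.
Fact cech_addN p : left_inverse (@cech_zero p) (@cech_opp p) (@cech_add p).
Proof.
move=> x; rewrite -[x]cech_reprK cech_opp_pi cech_add_pi.
exact/cech_piP/cocycle_addN.
Qed.

End Ops.

HB.instance Definition _ p := GRing.isZmodule.Build (cech p)
  (@cech_addA p) (@cech_addC p) (@cech_add0 p) (@cech_addN p).

(* The class of c, or 0 if c is not a cocycle. *)
Definition pointed_class (U : X -> set X) p (c : cochain X p) : cech p :=
  match pselect (pointed_cover U /\ is_cocycle U c) with
  | left h => cech_pi (Cocycle h.1 h.2)
  | right _ => 0
  end.

(* The class of a cocycle on a cover indexed by any type: restrict it along a
   function r with x in U (r x). *)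
Definition cech_class (I : Type) (U : I -> set X) p (c : cochain I p) : cech p :=
  match pselect (open_cover U) with
  | left h => let r x := projT1 (cid (h.2 x)) in
              pointed_class (U \o r) (fun s => c (r \o s))
  | right _ => 0
  end.

End Cech.
Arguments ccov [X A p] c _.
Arguments cfun [X A p] c _ _.

Definition pair_cochain (X : topologicalType) (A : topologicalZmodType)
    (I : Type) (h : I -> I -> X -> A) : cochain X A I 1 :=
  fun s => h (s ord0) (s ord_max).

Definition cech_pull (X X' : topologicalType) (A : topologicalZmodType)
    (f : X -> X') p (x : cech X' A p) : cech X A p :=
  pointed_class (fun z => f @^-1` ccov (repr x) (f z))
                (fun s z => cfun (repr x) (f \o s) (f z)).

(* Alexander-Whitney product of representatives, on a common refinement. *)
Definition cup (X : topologicalType) p q (x : cech X Zd p) (y : cech X Zd q) :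
    cech X Zd (p + q) :=
  pointed_class (meet_cover (ccov (repr x)) (ccov (repr y)))
    (fun s z => cfun (repr x) (fun k => s (inord k)) z *
                cfun (repr y) (fun k => s (inord (p + k))) z).

(* The graph of the connecting homomorphism of 0 -> Z -> R -> T -> 0, where
   R -> T is t |-> e^{2 i pi t}: on a sufficiently fine cover, lift to a real
   cochain phi and take its coboundary.  On paracompact Hausdorff spaces such
   lifts always exist and, for p > 0, this is the graph of an isomorphism. *)
Definition connecting (R : realType) (X : topologicalType) p
    (x : cech X (circle R) p) (y : cech X Zd p.+1) : Prop :=
  exists (U : X -> set X) (phi : cochain X R X p) (m : cochain X Zd X p.+1),
    let e : cochain X (circle R) X p := fun s z => expi (2 * pi * phi s z) in
    [/\ pointed_cover U, is_cochain U phi, is_cocycle U e & is_cocycle U m] /\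
    [/\ forall s z, overlap U s z -> cobound phi s z = (m s z : int)%:~R,
        x = pointed_class U e & y = pointed_class U m].

Definition generates (M : zmodType) (g : M) : Prop :=
  forall x, exists m : int, x = g *~ m.

(* A family of complex lines over Y.  The sum of two points is only meaningful
   when they lie in the same fibre. *)
Record line_family (R : realType) (Y : topologicalType) := LineFamily {
  lb_total : topologicalType;
  lb_proj : lb_total -> Y;
  lb_add : lb_total -> lb_total -> lb_total;
  lb_scale : Cx R -> lb_total -> lb_total }.

Arguments lb_proj {R Y l} _.

(* phi : V * C -> L is a homeomorphism onto the part of L over V, with inverse
   e |-> (lb_proj e, psi e), and it is linear on the fibres. *)
Definition trivialization (R : realType) (Y : topologicalType)
    (L : line_family R Y) (V : set Y)
    (phi : Y * Cx R -> lb_total L) (psi : lb_total L -> Cx R) : Prop :=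
  [/\ {within V `*` setT, continuous phi},
      {within lb_proj @^-1` V, continuous psi},
      forall y c, V y -> lb_proj (phi (y, c)) = y /\ psi (phi (y, c)) = c,
      forall e, V (lb_proj e) -> phi (lb_proj e, psi e) = e &
      forall y a c d, V y ->
        phi (y, a * c + d) = lb_add (lb_scale a (phi (y, c))) (phi (y, d))].

Definition is_line_bundle (R : realType) (Y : topologicalType)
    (L : line_family R Y) : Prop :=
  continuous (lb_proj : lb_total L -> Y) /\
  forall y, exists V phi psi, [/\ open V, V y & @trivialization R Y L V phi psi].

Definition trivial_bundle (R : realType) (Y : topologicalType)
    (L : line_family R Y) : Prop :=
  exists phi psi, @trivialization R Y L setT phi psi.

Definition transition_functions (R : realType) (Y : topologicalType)
    (L : line_family R Y) (I : Type) (V : I -> set Y)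
    (phi : I -> Y * Cx R -> lb_total L) (h : I -> I -> Y -> circle R) : Prop :=
  forall i j y c, V i y -> V j y -> phi j (y, c) = phi i (y, cval (h i j y) * c).

Section Hilbert.
Variable R : realType.
Local Notation C := (Cx R).

(* A Hilbert space is a complete normed space whose norm is given by an inner
   product.  The forms {dot V for Num.conj} are linear in their first argument;
   ip is the same inner product with the arguments in the order in which it is
   antilinear in the first one. *)
Definition hilbert (V : completeNormedModType C) (dot : {dot V for Num.conj}) :
  Prop := forall v, `|v| ^+ 2 = dot v v.

Definition ip (V : completeNormedModType C) (dot : {dot V for Num.conj})
  (v w : V) : C := dot w v.

Section Space.
Variables (V : completeNormedModType C) (dot : {dot V for Num.conj}).

Definition cspan (A : set V) : set V :=
  closure [set w | exists n (c : 'I_n -> C) (e : 'I_n -> V),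
                     (forall i, A (e i)) /\ w = \sum_i c i *: e i].

Definition closed_subspace (K : set V) : Prop :=
  [/\ closed K, K 0 & forall (c : C) v w, K v -> K w -> K (c *: v + w)].

Definition unitary (W : V -> V) : Prop :=
  [/\ forall (c : C) v w, W (c *: v + w) = c *: W v + W w,
      forall v w, ip dot (W v) (W w) = ip dot v w &
      forall w, exists v, W v = w].

(* The element of PU(V) = U(V) / T represented by W. *)
Definition PU_class (W : V -> V) : set (V -> V) :=
  [set W' | exists z : circle R, forall v, W' v = cval z *: W v].

Section Bundle.
Variables (X : topologicalType) (I : Type) (U : I -> set X).

(* ghat is a family of continuous lifts to U(V), with the strong operator
   topology, of the PU(V)-valued transition functions g. *)
Definition unitary_lift (g : I -> I -> X -> set (V -> V))
    (ghat : I -> I -> X -> V -> V) : Prop :=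
  [/\ forall i j x, U i x -> U j x ->
        unitary (ghat i j x) /\ g i j x = PU_class (ghat i j x) &
      forall i j v, {within U i `&` U j, continuous (fun x => ghat i j x v)}].

Definition PU_cocycle (g : I -> I -> X -> set (V -> V)) : Prop :=
  forall i j k x, U i x -> U j x -> U k x ->
    forall W W', g i j x W -> g j k x W' -> g i k x (W \o W').

(* f_ijk = ghat_ij ghat_jk ghat_ik^-1 *)
Definition dixmier_douady_cocycle (ghat : I -> I -> X -> V -> V)
    (f : cochain X (circle R) I 2) : Prop :=
  is_cocycle U f /\
  forall s x v, overlap U s x ->
    ghat (s ord0) (s (inord 1)) x (ghat (s (inord 1)) (s ord_max) x v) =
    cval (f s x) *: ghat (s ord0) (s ord_max) x v.

End Bundle.
End Space.

Section Fock.
Variables (H F : completeNormedModType C).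
Variables (dotH : {dot H for Num.conj}) (dotF : {dot F for Num.conj}).
Variables (u : int -> H) (Hp Hm : set H).

Definition polarization : Prop :=
  [/\ forall i j, ip dotH (u i) (u j) = (i == j)%:R,
      Hp = cspan [set u i | i in [set i | 0 <= i]],
      Hm = cspan [set u i | i in [set i | i < 0]] &
      forall f, exists f1 f2, [/\ Hp f1, Hm f2 & f = f1 + f2]].

Variables (a astar : H -> {linear F -> F}).

(* A *-representation of the CAR algebra of H on F; astar f is the adjoint of
   a f.  These relations make all the operators bounded. *)
Definition CAR_representation : Prop :=
  [/\ forall (c : C) f g v, a (c *: f + g) v = Num.conj c *: a f v + a g v,
      forall f v w, ip dotF (a f v) w = ip dotF v (astar f w),
      forall f g v, a f (a g v) + a g (a f v) = 0 &
      forall f g v, a f (astar g v) + astar g (a f v) = ip dotH f g *: v].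

Definition irreducible_representation : Prop :=
  forall K, closed_subspace K ->
    (forall f v, K v -> K (a f v) /\ K (astar f v)) ->
    K = [set 0] \/ K = setT.

Variable vac : F.

(* a(u_i1) ... a(u_ik) a*(u_j1) ... a*(u_jl) |0> *)
Definition fock_vector (ms ps : seq int) : F :=
  foldr (fun i => a (u i)) (foldr (fun j => astar (u j)) vac ps) ms.

Definition fock_indices (ms ps : seq int) : bool :=
  all (fun i => i < 0) ms && all (fun j => 0 <= j) ps.

Definition fock_space : Prop :=
  [/\ CAR_representation, irreducible_representation, `|vac| = 1,
      forall f, (Hp f -> a f vac = 0) /\ (Hm f -> astar f vac = 0) &
      cspan [set v | exists ms ps, fock_indices ms ps /\ v = fock_vector ms ps]
        = setT].

(* The charge subspace F^(k), on which the charge operator N is k. *)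
Definition charge_space (k : int) : set F :=
  cspan [set v | exists ms ps, [/\ fock_indices ms ps,
    (size ps)%:Z - (size ms)%:Z = k & v = fock_vector ms ps]].

(* hN z is the unitary operator z^N. *)
Definition charge_power (hN : circle R -> {linear F -> F}) : Prop :=
  forall z, unitary dotF (hN z) /\
    forall k v, charge_space k v -> hN z v = cval z ^ k *: v.

(* S is the unitary lift of the shift fixed by u 0, and Sinv its inverse. *)
Definition fock_shift (S Sinv : {linear F -> F}) : Prop :=
  [/\ unitary dotF S, cancel S Sinv /\ cancel Sinv S,
      S vac = astar (u 0) vac &
      forall k v, S (a (u k) (Sinv v)) = a (u (k + 1)) v /\
                  S (astar (u k) (Sinv v)) = astar (u (k + 1)) v].

End Fock.

Definition arc (s t : R) : set (circle R) := [set expi x | x in `]s, t[].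

Section ProjectiveFock.
Variables (F : completeNormedModType C) (hN : circle R -> {linear F -> F}).
Variables (S Sinv : {linear F -> F}) (Y : topologicalType) (n : nat).
Variables (V : 'I_n -> set Y) (h : 'I_n -> 'I_n -> Y -> circle R) (eps : R).

(* The index set is two copies of 'I_n: inl i stands for i and inr i for
   i + n. *)
Definition PF_cover (i : 'I_n + 'I_n) : set (circle R * Y) :=
  match i with
  | inl i => arc (- eps) (pi + eps) `*` V i
  | inr i => arc (pi - eps) (2 * pi + eps) `*` V i
  end.

(* arc (- eps) eps is the component around 1 of the intersection of the two
   arcs above; the other one is arc (pi - eps) (pi + eps). *)
Definition PF_lift (i j : 'I_n + 'I_n) (x : circle R * Y) : F -> F :=
  match i, j with
  | inl i, inl j | inr i, inr j => hN (h i j x.2)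
  | inl i, inr j =>
      if x.1 \in arc (- eps) eps then hN (h i j x.2) \o S else hN (h i j x.2)
  | inr j, inl i =>
      if x.1 \in arc (- eps) eps then Sinv \o hN (h j i x.2) else hN (h j i x.2)
  end.

Definition PF (i j : 'I_n + 'I_n) (x : circle R * Y) : set (F -> F) :=
  PU_class (PF_lift i j x).

End ProjectiveFock.
End Hilbert.

(* Main.v *)
(* Since S raises the charge by one, S z^N = z^-1 z^N S.  Over the arc around 1,
   where the two sheets of the circle are exchanged by S, the products of the lifts
   therefore differ by h_jk^(- w_ij) up to a coboundary, w being the Z-valued
   cocycle that counts the change of sheet; elsewhere they agree.  If phi is a real
   logarithm of h, with integral coboundary m, then - w phi is a logarithm of this
   cocycle, and its coboundary is the product w m.  So the Dixmier-Douady class is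
   the cup product of the class of w with that of m.

   The class of w generates: a Z-valued cocycle on the circle pulls back to the line,
   where it has a section, built by extending local ones up to a supremum.  The
   monodromy k of the section along a period is constant, and restricting the section
   to the logarithms on the two sheets exhibits the cocycle as - k w up to a
   coboundary. *)
Require Import Defs.
From mathcomp Require Import all_boot all_order all_algebra.
From mathcomp Require Import all_classical all_reals all_analysis.
From mathcomp Require Import complex ring lra.
Set Implicit Arguments.
Unset Strict Implicit.
Unset Printing Implicit Defensive.
Import Order.TTheory GRing.Theory Num.Theory.
Import numFieldNormedType.Exports.
Local Open Scope classical_set_scope.
Local Open Scope ring_scope.

(** Classes live on covers indexed by points, and [cech_class], [cech_pull] and [cup] go through
    index functions and representatives picked by choice. Identities are therefore proved for
    explicit cochains, and separate lemmas show that the classes do not depend on these picks. On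
    the product cover the picked index function is traded for one that splits into a sheet of the
    circle and a chart of [Y]; only then are the two factors genuine pullbacks along the
    projections.

    On the Fock side, [S] does not preserve the family of basis vectors: it sends a factor
    [a (u (-1))] to [a (u 0)], which is not allowed there. To see that [S] raises the charge, one
    has to know how every [a (u i)] and [astar (u i)] acts on the charge, whatever the sign of [i];
    the CAR bring the vectors back to the allowed form. The commutation of [S] with z^N then extends
    from the basis to [F] by density, both sides being unitary up to a phase.

    The coboundary that separates the Dixmier-Douady cocycle from the product comes from the order
    of the factors in S^-1 h^N. *)

(* Reflection: [zmod_eq] decides an equation of abelian groups by comparing the
   integer coefficients of the atoms. *)
Inductive zexpr : Type :=
  ZVar of nat | ZZero | ZAdd of zexpr & zexpr | ZOpp of zexpr.

Fixpoint zeval (M : zmodType) (env : seq M) (e : zexpr) : M :=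
  match e with
  | ZVar n => env`_n
  | ZZero => 0
  | ZAdd e1 e2 => zeval env e1 + zeval env e2
  | ZOpp e => - zeval env e
  end.

Fixpoint zcoef (e : zexpr) (i : nat) : int :=
  match e with
  | ZVar n => (i == n)%:R
  | ZZero => 0
  | ZAdd e1 e2 => zcoef e1 i + zcoef e2 i
  | ZOpp e => - zcoef e i
  end.

Lemma zevalE (M : zmodType) (env : seq M) e :
  zeval env e = \sum_(i < size env) env`_i *~ zcoef e i.
Proof.
elim: e => [n||e1 IH1 e2 IH2|e IH] /=.
- have [n_lt|n_ge] := ltnP n (size env).
    rewrite (bigD1 (Ordinal n_lt))//= eqxx mulr1z big1 ?addr0// => i.
    by rewrite -val_eqE /= => /negPf ->.
  (* A variable out of range has the default value 0 and no coefficient in the sum. *)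
  rewrite nth_default// big1// => i _.
  by rewrite (ltn_eqF (leq_trans (ltn_ord i) n_ge)).
- by rewrite big1.
- by rewrite IH1 IH2 -big_split; apply: eq_bigr => i _; rewrite mulrzDr.
- by rewrite IH -sumrN; apply: eq_bigr => i _; rewrite mulrNz.
Qed.

Lemma zeval_eq (M : zmodType) (env : seq M) e1 e2 :
  all (fun i => zcoef e1 i == zcoef e2 i) (iota 0 (size env)) ->
  zeval env e1 = zeval env e2.
Proof.
move=> /allP e12; rewrite !zevalE; apply: eq_bigr => i _.
by rewrite (eqP (e12 i _))// mem_iota /=.
Qed.

Ltac zindex x env :=
  lazymatch env with
  | cons x _ => constr:(O)
  | cons _ ?e => let n := zindex x e in constr:(S n)
  end.
Ltac zatoms t env :=
  lazymatch t with
  | (?a + ?b)%R => let env := zatoms a env in zatoms b env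
  | (- ?a)%R => zatoms a env
  | (0)%R => env
  | _ => lazymatch env with
         | context [cons t _] => env
         | _ => constr:(cons t env)
         end
  end.
Ltac zquote t env :=
  lazymatch t with
  | (?a + ?b)%R =>
      let a := zquote a env in let b := zquote b env in constr:(ZAdd a b)
  | (- ?a)%R => let a := zquote a env in constr:(ZOpp a)
  | (0)%R => constr:(ZZero)
  | _ => let n := zindex t env in constr:(ZVar n)
  end.
Ltac zmod_eq :=
  lazymatch goal with
  | |- @eq ?M ?a ?b =>
      let env := zatoms a (@nil M) in
      let env := zatoms b env in
      let ea := zquote a env in
      let eb := zquote b env in
      refine (@zeval_eq _ env ea eb _); vm_compute; reflexivity
  end.

(** * Cech cochains *)

Section Continuity.
Variables (X : topologicalType) (A : topologicalZmodType).
Implicit Types f g : X -> A.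

Lemma continuous_zmodD f g x :
  {for x, continuous f} -> {for x, continuous g} ->
  {for x, continuous (fun y => f y + g y)}.
Proof.
move=> cf cg.
apply: (@continuous_comp _ _ _ (fun y => (f y, g y)) (fun z : A * A => z.1 + z.2)).
  exact: cvg_pair.
exact: add_continuous.
Qed.

Lemma continuous_zmodN f x :
  {for x, continuous f} -> {for x, continuous (fun y => - f y)}.
Proof.
by move=> cf; apply: (@continuous_comp _ _ _ f -%R) => //; exact: opp_continuous.
Qed.

Lemma continuous_zmodMn f x n :
  {for x, continuous f} -> {for x, continuous (fun y => f y *+ n)}.
Proof.
move=> cf; elim: n => [|n IH]; first exact: cvg_cst.
rewrite (_ : (fun y => _) = (fun y => f y + f y *+ n)); first exact: continuous_zmodD.
by apply/funext => y; rewrite mulrS.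
Qed.

Lemma continuous_zmod_sum n (h : 'I_n -> X -> A) x :
  (forall i, {for x, continuous (h i)}) ->
  {for x, continuous (fun y => \sum_i h i y)}.
Proof.
elim: n h => [|n IH] h ch.
  rewrite (_ : (fun y => _) = (fun=> 0)); first exact: cst_continuous.
  by apply/funext => y; rewrite big_ord0.
rewrite (_ : (fun y => _) =
  (fun y => \sum_(i < n) h (widen_ord (leqnSn n) i) y + h ord_max y)).
  by apply: continuous_zmodD => //; exact: IH.
by apply/funext => y; rewrite big_ord_recr.
Qed.

Lemma continuous_zmodMz f x (m : int) :
  {for x, continuous f} -> {for x, continuous (fun y => f y *~ m)}.
Proof.
by case: m => n cf; [exact: continuous_zmodMn|exact/continuous_zmodN/continuous_zmodMn].
Qed.

Lemma continuous_near (T : topologicalType) (f g : X -> T) x :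
  (\forall y \near x, f y = g y) -> {for x, continuous f} ->
  {for x, continuous g}.
Proof.
move=> fg cf; rewrite /prop_for /continuous_at -(nbhs_singleton fg).
by apply: cvg_trans cf; exact: near_eq_cvg.
Qed.

Lemma continuous_near_cst (T : topologicalType) (f : X -> T) x :
  (\forall y \near x, f y = f x) -> {for x, continuous f}.
Proof.
move=> fx; apply: (@continuous_near _ (fun=> f x)); last exact: cvg_cst.
by near do apply/esym.
Unshelve. all: by end_near. Qed.

Lemma continuous_Zd_near (f : X -> Zd) x :
  {for x, continuous f} -> \forall y \near x, f y = f x.
Proof. by move/(_ [set f x]); apply; exact: (@discrete_set1 (discrete_topology int)). Qed.

Lemma continuous_zmodMZd f (a : X -> Zd) x :
  {for x, continuous f} -> {for x, continuous a} ->
  {for x, continuous (fun y => f y *~ (a y : int))}.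
Proof.
move=> cf /continuous_Zd_near ca.
apply: continuous_near (continuous_zmodMz (m := a x) cf).
by near=> y; rewrite (near ca y).
Unshelve. all: by end_near. Qed.

End Continuity.

Section Cochains.
Variables (X : topologicalType) (A : topologicalZmodType).

Lemma overlap_open I (U : I -> set X) p (s : 'I_p.+1 -> I) :
  (forall i, open (U i)) -> open (overlap U s).
Proof.
move=> oU; rewrite openE => x Ux; apply: filter_forall => k.
exact: open_nbhs_nbhs.
Qed.

(** Overlaps of open sets are open, so continuity of the restriction is continuity at each point;
    the local arguments below use this form. *)
Lemma is_cochainP I (U : I -> set X) p (c : cochain X A I p) :
  (forall i, open (U i)) ->
  is_cochain U c <-> forall s x, overlap U s x -> {for x, continuous (c s)}.
Proof.
move=> oU; split=> cc s.
  move=> x Ux; have := cc s; rewrite continuous_open_subspace; last exact: overlap_open.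
  by apply; rewrite inE.
rewrite continuous_open_subspace; last exact: overlap_open.
by move=> x /[!inE]; exact: cc.
Qed.

Lemma pointed_cover_open (U : X -> set X) : pointed_cover U -> forall x, open (U x).
Proof. by move=> pU x; case: (pU x). Qed.

Lemma lift_inord I p (s : 'I_p.+2 -> I) (k : 'I_p.+2) j : (j <= p)%N ->
  s (lift k (inord j)) = s (inord (bump k j)).
Proof.
move=> jp; congr s; apply: val_inj => /=; rewrite !inordK//.
by rewrite /bump ltnS; case: (k <= j)%N => //; exact: leqW.
Qed.

End Cochains.

(** * Products with an integral cochain of degree 0 or 1 *)

Section CapWithEdge.
Variables (X : topologicalType) (A : topologicalZmodType) (I : Type).

Definition edge p (s : 'I_p.+2 -> I) : 'I_2 -> I := fun k => s (inord k).

(* The Alexander-Whitney product of [a] with [c]: the integer [a (edge s)] acts on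
   the value of [c] at the remaining vertices.  For A = Zd this is the product
   that underlies [cup]. *)
Definition cup1 p (a : cochain X Zd I 1) (c : cochain X A I p) :
    cochain X A I p.+1 :=
  fun s x => c (s \o lift ord0) x *~ (a (edge s) x : int).

(** Companion of [cup1] in degree 0: it provides the primitive of [cup1 a c] when [a] is the
    coboundary of [b] and [c] is a cocycle. *)
Definition cup0 p (b : cochain X Zd I 0) (c : cochain X A I p) :
    cochain X A I p :=
  fun s x => c s x *~ (b (fun=> s ord0) x : int).

Lemma lift_lift0 p (s : 'I_p.+3 -> I) (k : 'I_p.+1) :
  s \o lift (lift ord0 (lift ord0 k)) \o lift ord0 =
  s \o lift ord0 \o lift (lift ord0 k).
Proof.
apply/funext => j /=; congr s; apply: val_inj.
by rewrite /= /bump /= !add1n ltnS addnS.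
Qed.

Lemma lift_lift1 p (s : 'I_p.+3 -> I) :
  s \o lift (lift ord0 ord0) \o lift ord0 = s \o lift ord0 \o lift ord0.
Proof. by apply/funext => j /=; congr s; apply: val_inj. Qed.

Lemma edge_lift p (s : 'I_p.+3 -> I) (k : 'I_3) :
  edge (s \o lift (inord k)) = (fun j : 'I_3 => s (inord j)) \o lift k.
Proof.
apply/funext => j /=; rewrite /edge /= lift_inord; last first.
  by rewrite -ltnS (leq_trans (ltn_ord j)).
by rewrite inordK// (leq_trans (ltn_ord k)).
Qed.

Lemma edge_lift_ge2 p (s : 'I_p.+3 -> I) (k : 'I_p.+1) :
  edge (s \o lift (lift ord0 (lift ord0 k))) = edge s.
Proof.
apply/funext => j /=; rewrite /edge /= lift_inord; last first.
  by rewrite -ltnS (leq_trans (ltn_ord j)).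
congr (s (inord _)).
by rewrite /bump leqNgt (leq_trans (ltn_ord j)).
Qed.

Lemma signr2z : (-1) ^+ 2 = 1 :> int. Proof. by []. Qed.
Lemma signr3z : (-1) ^+ 3 = -1 :> int. Proof. by []. Qed.

Lemma cobound1E (B : topologicalZmodType) (a : cochain X B I 1) s x :
  cobound a s x =
  a (s \o lift (inord 0)) x - a (s \o lift (inord 1)) x + a (s \o lift (inord 2)) x.
Proof.
rewrite /cobound !big_ord_recl big_ord0 /= expr0 expr1 signr2z mulrN1z !mulr1z addr0 addrA.
by do ![congr (_ + _) | congr (- _) | congr (a (s \o lift _) x)];
  apply: val_inj; rewrite /= inordK.
Qed.

(** This is the relation for [a] on the first three vertices of [s], written with the first edges of
    the faces 0 and 1 of [s]; face 2 has the same first edge as [s]. *)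
Lemma cocycle_edge (B : topologicalZmodType) (U : I -> set X) p
    (a : cochain X B I 1) (s : 'I_p.+3 -> I) x :
  is_cocycle U a -> overlap U s x ->
  a (edge (s \o lift ord0)) x =
  a (edge (s \o lift (lift ord0 ord0))) x - a (edge s) x.
Proof.
move=> [_ a0] Ux.
have /a0 : overlap U (fun k : 'I_3 => s (inord k)) x by move=> k; exact: Ux.
have e0 : inord 0 = ord0 :> 'I_p.+3 by apply: val_inj; rewrite /= inordK.
have e1 : inord 1 = lift ord0 ord0 :> 'I_p.+3 by apply: val_inj; rewrite /= inordK.
have e2 : inord 2 = lift ord0 (lift ord0 ord0) :> 'I_p.+3.
  by apply: val_inj; rewrite /= inordK.
rewrite cobound1E -!edge_lift !inordK// e0 e1 e2 edge_lift_ge2.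
move=> /eqP; rewrite addr_eq0 subr_eq => /eqP ->; zmod_eq.
Qed.

(** Leibniz rule for a cocycle [a]. Only faces 0 and 1 change the first edge, and the cocycle
    relation merges their two terms into one; the other faces act on [c] with their index lowered by
    one, whence the sign. *)
Lemma cobound_cup1 (U : I -> set X) p (a : cochain X Zd I 1)
    (c : cochain X A I p) s x :
  is_cocycle U a -> overlap U s x ->
  cobound (cup1 a c) s x = - cup1 a (cobound c) s x.
Proof.
move=> ca Ux; rewrite {2}/cup1 /cobound /cup1.
rewrite 2!big_ord_recl [in RHS]big_ord_recl /= expr0 expr1 !mulr1z mulrN1z.
under eq_bigr do rewrite edge_lift_ge2 lift_lift0.
rewrite (cocycle_edge ca Ux) lift_lift1 mulrzBr mulrzDl opprD.
have -> : \sum_(i < p.+1) c (s \o lift ord0 \o lift (lift ord0 i)) x *~ a (edge s) x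
    *~ (-1) ^+ lift ord0 (lift ord0 i) =
  - ((\sum_(i < p.+1) c (s \o lift ord0 \o lift (lift ord0 i)) x *~
    (-1) ^+ bump 0 i) *~ a (edge s) x).
  rewrite mulrz_suml -sumrN; apply: eq_bigr => i _.
  by rewrite mulrzAC !lift0 exprS mulN1r mulrNz mulNrz.
set t1 := _ *~ a (edge (s \o _)) x; set t2 := _ *~ a (edge s) x.
set t3 := _ *~ a (edge s) x; zmod_eq.
Qed.

Lemma cobound0E (B : topologicalZmodType) (b : cochain X B I 0) s x :
  cobound b s x = b (fun=> s ord_max) x - b (fun=> s ord0) x.
Proof.
rewrite /cobound !big_ord_recl big_ord0 /= expr0 expr1 mulr1z mulrN1z addr0.
by congr (b _ x - b _ x); apply/funext => j /=; congr s; apply: val_inj => /=;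
  rewrite (ord1 j).
Qed.

Lemma edge_max p (s : 'I_p.+2 -> I) : edge s ord_max = s (lift ord0 ord0).
Proof. by congr s; apply: val_inj; rewrite /= inordK. Qed.

Lemma edge0 p (s : 'I_p.+2 -> I) : edge s ord0 = s ord0.
Proof. by congr s; apply: val_inj; rewrite /= inordK. Qed.

(** Leibniz rule in degree 0: face 0 is the only one that moves the vertex at which [b] is read, and
    the correction is the term in [cobound b]. *)
Lemma cobound_cup0 p (b : cochain X Zd I 0) (c : cochain X A I p) s x :
  cobound (cup0 b c) s x =
  cup1 (cobound b) c s x + cup0 b (cobound c) s x.
Proof.
rewrite /cup1 cobound0E edge_max edge0 /cup0 /cobound.
rewrite big_ord_recl [in RHS]big_ord_recl /= !mulr1z.
rewrite mulrzBr mulrzDl addrA addrNK; congr (_ + _).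
rewrite mulrz_suml; apply: eq_bigr => i _.
by rewrite mulrzAC (_ : lift (lift ord0 i) ord0 = ord0)//; exact: val_inj.
Qed.

Variable U : I -> set X.
Hypothesis oU : forall i, open (U i).

Lemma overlap_edge p (s : 'I_p.+2 -> I) x : overlap U s x -> overlap U (edge s) x.
Proof. by move=> Ux k; exact: Ux. Qed.

Lemma overlap_lift p (s : 'I_p.+2 -> I) k x : overlap U s x -> overlap U (s \o lift k) x.
Proof. by move=> Ux j; exact: Ux. Qed.

Lemma is_cochain_cup1 p (a : cochain X Zd I 1) (c : cochain X A I p) :
  is_cochain U a -> is_cochain U c -> is_cochain U (cup1 a c).
Proof.
move=> /(is_cochainP _ oU) ca /(is_cochainP _ oU) cc; apply/is_cochainP => // s x Ux.
apply: continuous_zmodMZd; [apply: cc; exact: overlap_lift|].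
by apply: ca; exact: overlap_edge.
Qed.

Lemma is_cochain_cup0 p (b : cochain X Zd I 0) (c : cochain X A I p) :
  is_cochain U b -> is_cochain U c -> is_cochain U (cup0 b c).
Proof.
move=> /(is_cochainP _ oU) cb /(is_cochainP _ oU) cc; apply/is_cochainP => // s x Ux.
apply: continuous_zmodMZd; first exact: cc.
by apply: cb => k; exact: Ux.
Qed.

Lemma is_cocycle_cup1 p (a : cochain X Zd I 1) (c : cochain X A I p) :
  is_cocycle U a -> is_cocycle U c -> is_cocycle U (cup1 a c).
Proof.
move=> ca [cc c0]; split; first exact: is_cochain_cup1 ca.1 cc.
move=> s x Ux; rewrite (cobound_cup1 _ ca Ux) /cup1 c0; last exact: overlap_lift.
by rewrite mul0rz oppr0.
Qed.

Lemma is_coboundary_cup1l p (a : cochain X Zd I 1) (c : cochain X A I p) :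
  is_coboundary U a -> is_cocycle U c -> is_coboundary U (cup1 a c).
Proof.
move=> [b [cb bE]] [cc c0]; exists (cup0 b c); split; first exact: is_cochain_cup0.
move=> s x Ux; rewrite cobound_cup0 /cup0 c0// mul0rz addr0.
by rewrite /cup1 bE//; exact: overlap_edge.
Qed.

Lemma is_coboundary_cup1r p (a : cochain X Zd I 1) (c : cochain X A I p) :
  is_cocycle U a -> is_coboundary U c -> is_coboundary U (cup1 a c).
Proof.
case: p c => [|p] c ca.
  move=> c0; apply: is_coboundary0 => s x Ux; rewrite /cup1 c0 ?mul0rz//.
  exact: overlap_lift.
move=> [d [cd dE]]; exists (fun s x => - cup1 a d s x); split.
  exact/is_cochainN/is_cochain_cup1/cd/ca.1.
move=> s x Ux; rewrite coboundN (cobound_cup1 _ ca Ux) opprK.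
by rewrite /cup1 dE//; exact: overlap_lift.
Qed.

End CapWithEdge.

Lemma continuous_comp_at (X Y Z : topologicalType) (f : X -> Y) (g : Y -> Z) x :
  {for x, continuous f} -> {for f x, continuous g} ->
  {for x, continuous (fun y => g (f y))}.
Proof. exact: continuous_comp. Qed.

(** * Classes on pointed covers, pullbacks and cup products *)

Section PointedClasses.
Variables (X : topologicalType) (A : topologicalZmodType).

Lemma pointed_classE (U : X -> set X) p (c : cochain X A X p)
    (pU : pointed_cover U) (cU : is_cocycle U c) :
  pointed_class U c = cech_pi (Cocycle pU cU).
Proof.
rewrite /pointed_class; case: pselect => [[pU' cU']|[]//].
by congr cech_pi; congr Cocycle; exact: Prop_irrelevance.
Qed.

Lemma pointed_classP (U V : X -> set X) p (c d : cochain X A X p) :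
  pointed_cover U -> is_cocycle U c -> pointed_cover V -> is_cocycle V d ->
  pointed_class U c = pointed_class V d <->
  exists W, [/\ pointed_cover W, forall x, W x `<=` U x, forall x, W x `<=` V x &
    is_coboundary W (fun s x => c s x - d s x)].
Proof. by move=> pU cU pV cV; rewrite !pointed_classE; exact: cech_piP. Qed.

Lemma pointed_class_repr p (x : cech X A p) :
  pointed_class (ccov (repr x)) (cfun (repr x)) = x.
Proof.
rewrite (pointed_classE (ccov_pointed _) (ccocycle _)) -[RHS]cech_reprK.
by congr cech_pi; case: (repr x).
Qed.

End PointedClasses.

Section Pullback.
Variables (X X' : topologicalType) (f : X -> X').
Hypothesis cf : continuous f.

Definition pull_cover (U : X' -> set X') : X -> set X := fun z => f @^-1` U (f z).
Definition pull_cochain (A : topologicalZmodType) p (c : cochain X' A X' p) :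
  cochain X A X p := fun s z => c (f \o s) (f z).

Lemma pull_cover_pointed U : pointed_cover U -> pointed_cover (pull_cover U).
Proof.
by move=> pU z; split; [move/continuousP: cf; apply|]; case: (pU (f z)).
Qed.

Lemma is_cochain_pull (A : topologicalZmodType) U p (c : cochain X' A X' p) :
  pointed_cover U -> is_cochain U c -> is_cochain (pull_cover U) (pull_cochain c).
Proof.
move=> pU /(is_cochainP _ (pointed_cover_open pU)) cc.
apply/is_cochainP => [|s x Ux]; first exact/pointed_cover_open/pull_cover_pointed.
by apply: continuous_comp_at; [exact: cf|apply: cc => k; exact: Ux].
Qed.

Lemma is_cocycle_pull (A : topologicalZmodType) U p (c : cochain X' A X' p) :
  pointed_cover U -> is_cocycle U c -> is_cocycle (pull_cover U) (pull_cochain c).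
Proof.
move=> pU [cc c0]; split; first exact: is_cochain_pull.
by move=> s x Ux; apply: (c0 (f \o s)) => k; exact: Ux.
Qed.

Lemma is_coboundary_pull (A : topologicalZmodType) U p (c : cochain X' A X' p) :
  pointed_cover U -> is_coboundary U c -> is_coboundary (pull_cover U) (pull_cochain c).
Proof.
case: p c => [|p] c pU.
  by move=> c0 s x Ux; apply: c0 => k; exact: Ux.
move=> [b [cb bE]]; exists (pull_cochain b); split; first exact: is_cochain_pull.
by move=> s x Ux; rewrite /pull_cochain bE// => k; exact: Ux.
Qed.

(** Any representative computes the pullback: a refinement on which two representatives become
    cohomologous pulls back to one with the same property. *)
Lemma cech_pull_pointed (A : topologicalZmodType) U p (c : cochain X' A X' p) :
  pointed_cover U -> is_cocycle U c ->
  cech_pull f (pointed_class U c) = pointed_class (pull_cover U) (pull_cochain c).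
Proof.
move=> pU cU; rewrite /cech_pull; set r := repr _.
have := pointed_class_repr (pointed_class U c); rewrite -/r.
have pr := ccov_pointed r; have cr := ccocycle r.
move=> /(pointed_classP pr cr pU cU)[W [pW Wr WU cW]].
apply/(pointed_classP (pull_cover_pointed pr) (is_cocycle_pull pr cr)
  (pull_cover_pointed pU) (is_cocycle_pull pU cU)).
exists (pull_cover W); split.
- exact: pull_cover_pointed.
- by move=> x z /Wr.
- by move=> x z /WU.
- exact: (is_coboundary_pull pW cW).
Qed.

End Pullback.

Lemma Zd_mulrz (x y : Zd) : x *~ (y : int) = x * y.
Proof. by rewrite -mulrzr; congr (x * _); exact: intz. Qed.

Section Cup.
Variable X : topologicalType.

(** Any representatives compute the product. With [r] and [t] the chosen ones, r t - a c = (r - a) t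
    + a (t - c), and each summand is the product of a coboundary and a cocycle. *)
Lemma cup_pointed U V p (a : cochain X Zd X 1) (c : cochain X Zd X p) :
  pointed_cover U -> is_cocycle U a -> pointed_cover V -> is_cocycle V c ->
  cup (pointed_class U a) (pointed_class V c) =
  pointed_class (meet_cover U V) (cup1 a c) :> cech X Zd p.+1.
Proof.
move=> pU ca pV cc; rewrite /cup; set r := repr _; set t := repr _.
have pr := ccov_pointed r; have cr := ccocycle r.
have pt := ccov_pointed t; have ct := ccocycle t.
have := pointed_class_repr (pointed_class U a); rewrite -/r.
move=> /(pointed_classP pr cr pU ca)[W [pW Wr WU [b [cb bE]]]].
have := pointed_class_repr (pointed_class V c); rewrite -/t.
move=> /(pointed_classP pt ct pV cc)[W' [pW' W't W'V dW']].
have -> : (fun (s : 'I_(1 + p).+1 -> X) z =>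
     cfun r (fun k => s (inord k)) z * cfun t (fun k => s (inord (1 + k))) z) =
    cup1 (cfun r) (cfun t).
  apply/funext => s; apply/funext => z; rewrite /cup1 mulrC.
  rewrite Zd_mulrz; congr (cfun t _ z * _).
  by apply/funext => k /=; congr s; apply: val_inj; rewrite /= inordK// ltnS.
have cup1_cocycle (U1 V1 : X -> set X) a1 (c1 : cochain X Zd X p) :
    pointed_cover U1 -> is_cocycle U1 a1 -> pointed_cover V1 -> is_cocycle V1 c1 ->
    is_cocycle (meet_cover U1 V1) (cup1 a1 c1).
  move=> pU1 ca1 pV1 cc1; apply: is_cocycle_cup1.
  - exact/pointed_cover_open/meet_pointed.
  - by apply: (is_cocycle_comp (r := id)) ca1 => j x [].
  - by apply: (is_cocycle_comp (r := id)) cc1 => j x [].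
apply/pointed_classP; [exact: meet_pointed|exact: cup1_cocycle|exact: meet_pointed|
  exact: cup1_cocycle|].
exists (meet_cover W W'); split.
- exact: meet_pointed.
- by move=> x z [/Wr ? /W't ?]; split.
- by move=> x z [/WU ? /W'V ?]; split.
have oW := pointed_cover_open (meet_pointed pW pW').
have sub p' B U1 (e : cochain X B X p') : (forall x, meet_cover W W' x `<=` U1 x) ->
    is_cocycle U1 e -> is_cocycle (meet_cover W W') e.
  exact: (is_cocycle_comp (r := id)).
have ra : is_coboundary (meet_cover W W') (cup1 (fun s x => cfun r s x - a s x) (cfun t)).
  apply: is_coboundary_cup1l => //; last by apply: sub ct => x z [_ /W't].
  apply: is_coboundaryW (_ : is_coboundary W _) => [x z []//|//|].
  by exists b.
have tc : is_coboundary (meet_cover W W') (cup1 a (fun s x => cfun t s x - c s x)).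
  apply: is_coboundary_cup1r => //; first by apply: sub ca => x z [/WU].
  by apply: is_coboundaryW dW' => // x z [].
apply: is_coboundaryW (is_coboundaryD ra tc) => [x z//|s x _].
by rewrite /cup1 mulrzBr mulrzBl addrA subrK.
Qed.
End Cup.

(** * Simplices with listed vertices, and change of refinement *)

Section Vertices.
Variable I : Type.

Definition vtx3 (i j k : I) : 'I_3 -> I := fun l => nth i [:: i; j; k] l.
Definition vtx4 (i j k l : I) : 'I_4 -> I := fun m => nth i [:: i; j; k; l] m.

Lemma vtx3_eta (s : 'I_3 -> I) : s = vtx3 (s ord0) (s (inord 1)) (s ord_max).
Proof.
by apply/funext => -[[|[|[|//]]] lt_k]; congr s; apply: val_inj; rewrite /= ?inordK.
Qed.

Lemma vtx4_eta (s : 'I_4 -> I) :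
  s = vtx4 (s ord0) (s (inord 1)) (s (inord 2)) (s ord_max).
Proof.
by apply/funext => -[[|[|[|[|//]]]] lt_k]; congr s; apply: val_inj; rewrite /= ?inordK.
Qed.

Variables (X : topologicalType) (A : topologicalZmodType).

Lemma cobound_vtx4 (c : cochain X A I 2) i j k l x :
  cobound c (vtx4 i j k l) x =
  c (vtx3 j k l) x - c (vtx3 i k l) x + c (vtx3 i j l) x - c (vtx3 i j k) x.
Proof.
rewrite /cobound !big_ord_recl big_ord0 /= expr0 expr1 signr2z signr3z.
rewrite !mulrN1z !mulr1z addr0 !addrA.
have e (s s' : 'I_3 -> I) : (forall k, s k = s' k) -> c s x = c s' x.
  by move=> /funext ->.
by congr (_ - _ + _ - _); apply: e => -[[|[|[|//]]] lt_k].
Qed.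

Lemma cobound_pair (h : I -> I -> X -> A) s x :
  cobound (pair_cochain h) s x =
  h (s (inord 1)) (s ord_max) x - h (s ord0) (s ord_max) x + h (s ord0) (s (inord 1)) x.
Proof.
rewrite cobound1E /pair_cochain /=.
have -> : lift (inord 0) ord0 = inord 1 :> 'I_3 by apply: val_inj; rewrite /= !inordK.
have -> : lift (inord 1) ord0 = ord0 :> 'I_3 by apply: val_inj; rewrite /= inordK.
have -> : lift (inord 2) ord0 = ord0 :> 'I_3 by apply: val_inj; rewrite /= inordK.
have -> : lift (inord 0) ord_max = ord_max :> 'I_3 by apply: val_inj; rewrite /= inordK.
have -> : lift (inord 1) ord_max = ord_max :> 'I_3 by apply: val_inj; rewrite /= inordK.
by have -> : lift (inord 2) ord_max = inord 1 :> 'I_3 by apply: val_inj; rewrite /= !inordK.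
Qed.

Lemma cobound_cobound_pair (b : I -> I -> X -> A) s x :
  cobound (cobound (pair_cochain b)) s x = 0.
Proof.
rewrite (vtx4_eta s) cobound_vtx4 !cobound_pair /vtx3 /= !inordK//=; zmod_eq.
Qed.

Lemma overlap_vtx3 (U : I -> set X) i j k x :
  overlap U (vtx3 i j k) x <-> [/\ U i x, U j x & U k x].
Proof.
split=> [Ux|[Ui Uj Uk] [[|[|[|//]]] lt_k]//].
by split; [exact: (Ux ord0)|have := Ux (inord 1)|exact: (Ux ord_max)]; rewrite /vtx3 inordK.
Qed.

Lemma overlap_vtx4 (U : I -> set X) i j k l x :
  U i x -> U j x -> U k x -> U l x -> overlap U (vtx4 i j k l) x.
Proof. by move=> Ui Uj Uk Ul [[|[|[|[|//]]]] lt_k]. Qed.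

Lemma cocycle_vtx (U : I -> set X) (c : cochain X A I 2) i j k l x :
  is_cocycle U c -> U i x -> U j x -> U k x -> U l x ->
  c (vtx3 j k l) x - c (vtx3 i k l) x + c (vtx3 i j l) x - c (vtx3 i j k) x = 0.
Proof.
by move=> [_ c0] Ui Uj Uk Ul; rewrite -cobound_vtx4 c0//; exact: overlap_vtx4.
Qed.

End Vertices.

(* The usual chain homotopy between the pullbacks along [r] and [r']. *)
Lemma pointed_class_refine2 (X : topologicalType) (A : topologicalZmodType)
    (I : Type) (U : I -> set X) (c : cochain X A I 2) (r r' : X -> I) :
  (forall i, open (U i)) -> is_cocycle U c ->
  (forall x, U (r x) x) -> (forall x, U (r' x) x) ->
  pointed_class (U \o r) (fun s => c (r \o s)) =
  pointed_class (U \o r') (fun s => c (r' \o s)).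
Proof.
move=> oU cc Ur Ur'.
have pcov q : (forall x, U (q x) x) -> pointed_cover (U \o q).
  by move=> Uq x; split=> //=; exact: oU.
have ccomp (q : X -> I) : is_cocycle (U \o q) (fun s => c (q \o s)).
  by apply: (is_cocycle_comp (r := q)) cc => j x.
apply/pointed_classP => //; [exact: pcov|exact: pcov|].
exists (meet_cover (U \o r) (U \o r')); split.
- by apply: meet_pointed; exact: pcov.
- by move=> x z [].
- by move=> x z [].
have oM : forall x, open (meet_cover (U \o r) (U \o r') x).
  by move=> x; apply: openI; exact: oU.
exists (pair_cochain (fun p q x => c (vtx3 (r p) (r q) (r' q)) x -
  c (vtx3 (r p) (r' p) (r' q)) x)); split.
  apply/is_cochainP => // s x Ux; move/(is_cochainP _ oU): cc.1 => ccont.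
  have [Ur0 Ur'0] := Ux ord0; have [Ur1 Ur'1] := Ux ord_max.
  by apply: continuous_zmodD; last apply: continuous_zmodN; apply: ccont; apply/overlap_vtx3.
move=> s x Ux; rewrite cobound_pair.
have [Ur0 Ur0'] := Ux ord0; have [Ur1 Ur1'] := Ux (inord 1).
have [Ur2 Ur2'] := Ux ord_max.
(* The cocycle relations on the three tetrahedra that subdivide the prism from [r \o s] to
   [r' \o s]. *)
have B := cocycle_vtx cc Ur0 Ur1 Ur1' Ur2'.
have C := cocycle_vtx cc Ur0 Ur1 Ur2 Ur2'.
have D := cocycle_vtx cc Ur0 Ur0' Ur1' Ur2'.
rewrite (vtx3_eta (r \o s)) (vtx3_eta (r' \o s)) /=.
apply/eqP; rewrite -subr_eq0; apply/eqP.
transitivity (0 - 0 - 0 : A); last by rewrite !subr0.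
by rewrite -{1}B -{1}C -D; zmod_eq.
Qed.

(** * The circle *)

Section ComplexTopology.
Variable R : realType.

Lemma real_complex_continuous : continuous (real_complex R : R -> Cx R).
Proof.
move=> x; apply/cvgrPdist_lt => e; rewrite ltcE /= => /andP[/eqP Ime e_gt0].
near=> y; rewrite -rmorphB normc_def /= expr0n addr0 sqrtr_sqr ltcE /= Ime eqxx /=.
by near: y; apply: cvgr_dist_lt.
Unshelve. all: by end_near. Qed.

Lemma Re_continuous : continuous (@complex.Re R : Cx R -> R).
Proof.
move=> x; apply/(@cvgrPdist_lt _ _ _ (nbhs x)) => e e_gt0; near=> y.
have : `|x - y| < e%:C%C by near: y; apply: cvgr_dist_lt => //; rewrite ltcR.
rewrite normc_def ltcR; apply: le_lt_trans; rewrite -raddfB/= -sqrtr_sqr.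
by rewrite ler_wsqrtr// lerDl sqr_ge0.
Unshelve. all: by end_near. Qed.

Lemma Im_continuous : continuous (@complex.Im R : Cx R -> R).
Proof.
move=> x; apply/(@cvgrPdist_lt _ _ _ (nbhs x)) => e e_gt0; near=> y.
have : `|x - y| < e%:C%C by near: y; apply: cvgr_dist_lt => //; rewrite ltcR.
rewrite normc_def ltcR; apply: le_lt_trans; rewrite -raddfB/= -sqrtr_sqr.
by rewrite ler_wsqrtr// lerDr sqr_ge0.
Unshelve. all: by end_near. Qed.

Lemma continuous_Complex (X : topologicalType) (f g : X -> R) x :
  {for x, continuous f} -> {for x, continuous g} ->
  {for x, continuous (fun y => (f y +i* g y)%C : Cx R)}.
Proof.
move=> cf cg.
rewrite (_ : (fun y => _) = (fun y => (f y)%:C%C + 'i%C * (g y)%:C%C : Cx R)); last first.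
  by apply/funext => y; rewrite [LHS]complexE.
apply: continuousD.
  by apply: continuous_comp_at => //; exact: real_complex_continuous.
apply: continuousM; first exact: cst_continuous.
by apply: continuous_comp_at => //; exact: real_complex_continuous.
Qed.

End ComplexTopology.

Section Expi.
Variable R : realType.
Local Notation T := (circle R).
Implicit Types (s t x y : R) (z w : T).

Lemma cvg_circle (X : Type) (F : set_system X) (FF : Filter F) (f : X -> T) z :
  cval (f q) @[q --> F] --> cval z -> f @ F --> z.
Proof.
move=> cf U [?/= [[W oW <-]]] /= Wz /filterS; apply; apply: cf.
exact: open_nbhs_nbhs.
Qed.

Lemma continuous_circle (X : topologicalType) (f : X -> T) (p : X) :
  {for p, continuous (fun q => cval (f q))} -> {for p, continuous f}.
Proof. exact: cvg_circle. Qed.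

Lemma expi_continuous : continuous (@expi R).
Proof.
move=> t; apply: continuous_circle; apply: continuous_Complex.
  exact: continuous_cos.
exact: continuous_sin.
Qed.

Lemma cvalD z w : cval (z + w) = cval z * cval w. Proof. by []. Qed.
Lemma cval0 : cval (0 : T) = 1. Proof. by []. Qed.
Lemma cval_expiE t : cval (expi t) = (cos t +i* sin t)%C. Proof. by []. Qed.

Lemma expiD s t : expi (s + t) = expi s + expi t.
Proof.
apply: cval_inj; rewrite cvalD !cval_expiE cosD sinD.
by apply/eqP; rewrite eq_complex /= addrC (addrC (sin s * _)) !eqxx.
Qed.

Lemma expi0 : expi (0 : R) = 0.
Proof. by apply: cval_inj; rewrite cval_expiE cos0 sin0. Qed.

Lemma expiN t : expi (- t) = - expi t.
Proof. by apply/eqP; rewrite -addr_eq0 -expiD addNr expi0. Qed.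

Lemma expiMz t (m : int) : expi (t *~ m) = expi t *~ m.
Proof.
have expiMn n : expi (t *+ n) = expi t *+ n.
  by elim: n => [|n IH]; rewrite ?expi0// !mulrS expiD IH.
by case: m => n; rewrite ?NegzE ?mulrNz -?pmulrn ?expiN expiMn.
Qed.

Lemma expi2pi : expi (2 * pi : R) = 0.
Proof.
by apply: cval_inj; rewrite cval_expiE mulr_natl cos2pi sin2pi.
Qed.

(** By the half-angle formula cos t = 1 forces sin (t / 2) = 0, and t / 2 lies strictly between - pi
    and pi, where the sine vanishes only at 0. *)
Lemma expi_eq0 t : `|t| < 2 * pi -> expi t = 0 -> t = 0.
Proof.
move=> t_lt /(congr1 (@cval R)) [cos_t _].
have sin_t2 : sin (t / 2) = 0.
  apply/eqP; rewrite -sqrf_eq0 sin2cos2 subr_eq0 eq_sym; apply/eqP.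
  have := cos_mulr2n (t / 2); rewrite -[X in cos X]mulr_natr divfK ?pnatr_eq0// cos_t.
  by move=> ?; lra.
have [t_gt0|t_lt0|//] := ltgtP 0 t.
  have : 0 < sin (t / 2) by apply: sin_gt0_pi; rewrite gtr0_norm in t_lt => //; lra.
  by rewrite sin_t2 ltxx.
have : 0 < sin (- (t / 2)) by apply: sin_gt0_pi; rewrite ltr0_norm in t_lt => //; lra.
by rewrite sinN sin_t2 oppr0 ltxx.
Qed.

Lemma expi_inj x y : `|x - y| < 2 * pi -> expi x = expi y -> x = y.
Proof.
move=> xy exy; apply/eqP; rewrite -subr_eq0; apply/eqP/expi_eq0 => //.
by rewrite expiD expiN exy subrr.
Qed.

Lemma cval_sqr z : complex.Re (cval z) ^+ 2 + complex.Im (cval z) ^+ 2 = 1.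
Proof.
by have := add_Re2_Im2 (cval z); rewrite cval_norm expr1n => -[].
Qed.

Lemma cval_expi t z : complex.Re (cval z) = cos t -> complex.Im (cval z) = sin t ->
  z = expi t.
Proof. by move=> c s; apply/cval_inj/eqP; rewrite eq_complex cval_expiE /= c s !eqxx. Qed.

Lemma expi_surj z : exists2 t, 0 <= t < 2 * pi & expi t = z.
Proof.
set a := complex.Re (cval z); set b := complex.Im (cval z).
have ab : a ^+ 2 + b ^+ 2 = 1 := cval_sqr z.
have a1 : -1 <= a <= 1 by apply/andP; split; nra.
have cos_a : cos (acos a) = a by rewrite acosK// in_itv.
have sin_a : sin (acos a) = `|b|.
  by rewrite sin_acos// -ab addrC addKr sqrtr_sqr.
have := acos_ge0 a1; have := acos_lepi a1; have := pi_gt0 R => pi_gt0 api a0.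
have [b_ge0|b_lt0] := leP 0 b.
  exists (acos a); first by apply/andP; split; lra.
  by apply/esym/cval_expi; rewrite ?cos_a ?sin_a// ger0_norm.
(* The lower half circle is reached at 2 pi - acos a, which has to be strictly below 2 pi; acos a =
   0 would give b = 0. *)
have {}a0 : 0 < acos a; first rewrite lt0r a0 andbT.
  apply: contraTneq b_lt0 => a_eq0; move: sin_a; rewrite a_eq0 sin0 -leNgt => /esym/eqP.
  by rewrite normr_eq0 => /eqP ->.
exists (- acos a + pi *+ 2); first by apply/andP; split; lra.
apply/esym/cval_expi; rewrite ?cosD2pi ?sinD2pi ?cosN ?sinN ?cos_a ?sin_a//.
by rewrite ltr0_norm// opprK.
Qed.

(** Openness of the exponential, by an explicit local inverse: after the rotation that takes
    [expi x] to 1, it is x + asin (Im w), valid where Re w > 0. *)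
Lemma expi_nbhs (x : R) (N : set R) : nbhs x N -> nbhs (expi x) (@expi R @` N).
Proof.
move=> xN; pose w (z : T) : Cx R := cval (z - expi x).
have cw : {for expi x, continuous w}.
  apply: continuous_comp_at; last exact: cval_continuous.
  by apply: (@continuous_zmodD _ _ id (fun=> - expi x)); [move=> U|exact: cst_continuous].
have wx : w (expi x) = 1 by rewrite /w subrr.
pose l z := x + asin (complex.Im (w z)).
have cl : {for expi x, continuous l}.
  apply: continuousD; first exact: cst_continuous.
  apply: (@continuous_comp_at _ _ _ _ (@asin R)).
  by apply: continuous_comp_at => //; exact: Im_continuous.
  by rewrite wx; apply: continuous_asin; rewrite /=; lra.
have asin0 : asin (0 : R) = 0.
  by rewrite -[in LHS]sin0; apply: sinK; rewrite in_itv /=; have := pi_gt0 R; lra.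
have lx : l (expi x) = x by rewrite /l wx /= asin0 addr0.
have cRe : {for expi x, continuous (fun z => complex.Re (w z))}.
  by apply: continuous_comp_at => //; exact: Re_continuous.
have Nl : \forall z \near expi x, N (l z) by apply: cl; rewrite lx.
have Re_gt0 : \forall z \near expi x, 0 < complex.Re (w z).
  by apply: (cvgr_gt _ cRe); rewrite wx.
near=> z; exists (l z); first by near: z.
have := cval_sqr (z - expi x); rewrite -/(w z).
have : 0 < complex.Re (w z) by near: z.
set a := complex.Re _; set b := complex.Im _ => a_gt0 ab.
have b1 : -1 <= b <= 1 by apply/andP; split; nra.
rewrite /l expiD -/b -[RHS](addrNK (expi x)) addrC; congr (_ + _).
apply/esym/cval_expi; first by rewrite cos_asin// -ab addrK sqrtr_sqr gtr0_norm.
by rewrite asinK// in_itv.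
Unshelve. all: by end_near. Qed.

Lemma arc_open s t : open (Defs.arc s t).
Proof.
rewrite openE => z [x x_st <-]; apply: filterS (expi_nbhs (N := `]s, t[%classic) _).
  by [].
by apply: open_nbhs_nbhs; split=> //; exact: interval_open.
Qed.

(** The range contains every difference of logarithms on the two sheets, but only the multiples 0
    and 1 of 2 pi. *)
Lemma expi_two x y : - (2 * pi) < y - x < 4 * pi -> expi x = expi y ->
  y = x \/ y = x + 2 * pi.
Proof.
move=> /andP[lo hi] exy; have [lt2|ge2] := ltP (y - x) (2 * pi); [left|right].
  by apply/esym/expi_inj => //; rewrite distrC ltr_norml lo.
apply/esym/expi_inj; last by rewrite expiD expi2pi addr0.
by have := pi_gt0 R; rewrite ltr_norml; lra.
Qed.

End Expi.

(** * The two sheets of the circle and the winding cocycle *)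

Section Sheets.
Variables (R : realType) (eps : R).
Hypotheses (eps_gt0 : 0 < eps) (eps_small : eps < pi / 2).
Local Notation T := (circle R).
Implicit Types (x y : R) (z w : T) (b : bool).

Let pi_gt0 : 0 < pi :> R. Proof. exact: pi_gt0. Qed.
Let eps_bounds : [/\ 0 < eps, eps < pi / 2 & 0 < pi :> R]. Proof. by []. Qed.
Local Ltac elra := have [? ? ?] := eps_bounds; lra.

(** [false] stands for the sheet of the indices i, and [true] for that of the indices i + n. *)
Definition sheet_lo b : R := if b then pi - eps else - eps.
Definition sheet_hi b : R := if b then 2 * pi + eps else pi + eps.
Definition sheet b : set T := Defs.arc (sheet_lo b) (sheet_hi b).
Definition near1 z : bool := z \in Defs.arc (- eps) eps.
Definition slog b z : R :=
  xget 0 [set x | sheet_lo b < x < sheet_hi b /\ expi x = z].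

Lemma sheet_open b : open (sheet b). Proof. exact: arc_open. Qed.

Lemma slogP b z : sheet b z ->
  sheet_lo b < slog b z < sheet_hi b /\ expi (slog b z) = z.
Proof.
move=> [x] /=; rewrite in_itv /= => x_in xz.
by apply: (@xgetPex _ 0 [set t | sheet_lo b < t < sheet_hi b /\ expi t = z]); exists x.
Qed.

Lemma slogK b x : sheet_lo b < x < sheet_hi b -> slog b (expi x) = x.
Proof.
move=> x_in; have sx : sheet b (expi x) by exists x => //=; rewrite in_itv.
have [l_in l_eq] := slogP sx; apply: expi_inj => //.
by move: l_in x_in; rewrite /sheet_lo /sheet_hi ltr_norml; case: b {sx l_eq} => /= ? ?; elra.
Qed.

Lemma slog_continuous b z : sheet b z -> {for z, continuous (slog b)}.
Proof.
move=> /slogP[l_in lz] N; rewrite nbhs_simpl /= => Nl.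
have : nbhs (expi (slog b z)) (@expi R @` (N `&` `]sheet_lo b, sheet_hi b[%classic)).
  apply/expi_nbhs/filterI => //; apply: open_nbhs_nbhs; split; first exact: interval_open.
  by rewrite /= in_itv.
rewrite lz; apply: filterS => w [x [Nx]] /=; rewrite in_itv /= => x_in <-.
by rewrite slogK.
Qed.

(** The two logarithms differ by 0 or by 2 pi. The bounds of the sheets put their common value
    within [eps] of pi in the first case, and the logarithm on the first sheet within [eps] of 0 in
    the second. *)
Lemma slog_near1 z : sheet false z -> sheet true z ->
  slog true z = slog false z + (if near1 z then 2 * pi else 0).
Proof.
move=> /slogP[] /=; set x := slog false z => x_in xz.
move=> /slogP[] /=; set y := slog true z => y_in yz.
have [||yx|yE] := @expi_two R x y; first (by apply/andP; split; elra); first by rewrite xz yz.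
  rewrite yx /near1; case: ifPn; rewrite ?addr0// inE => -[u] /=; rewrite in_itv /= => u_in uz.
  have : u = x by apply: expi_inj; rewrite ?uz ?xz// ltr_norml; apply/andP; split; elra.
  by elra.
rewrite /near1; case: ifPn => //; rewrite notin_setE => -[].
by exists x => //=; rewrite in_itv /=; elra.
Qed.

(** The sheets meet in two open arcs, around 1 and around -1; they are disjoint because eps < pi /
    2. *)
Lemma near1_near z : sheet false z -> sheet true z ->
  \forall w \near z, near1 w = near1 z.
Proof.
move=> sf st; have := slog_near1 sf st; have [] := slogP sf; have [] := slogP st.
rewrite /=; set x := slog false z; set y := slog true z => y_in yz x_in xz.
case: ifPn => [|]; rewrite /near1.
  rewrite inE => z1 _; have : nbhs z (Defs.arc (- eps) eps).
    by apply: open_nbhs_nbhs; split; [exact: arc_open|].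
  by apply: filterS => w w1; rewrite mem_set// mem_set.
move=> _ yx; have : nbhs z (Defs.arc (pi - eps) (pi + eps)).
  apply: open_nbhs_nbhs; split; first exact: arc_open.
  by exists x => //=; rewrite in_itv /=; elra.
apply: filterS => w [u] /=; rewrite in_itv /= => u_in uw.
apply/negbTE; rewrite notin_setE => -[v] /=; rewrite in_itv /= => v_in vw.
have : u = v by apply: expi_inj; rewrite ?uw ?vw// ltr_norml; apply/andP; split; elra.
by elra.
Qed.

Definition sheet_of z : bool := ~~ `[< sheet false z >].

Lemma sheet_ofP z : sheet (sheet_of z) z.
Proof.
rewrite /sheet_of; case: asboolP => //= nf; have [t t_in tz] := expi_surj z.
exists t => //=; rewrite in_itv /=; apply/andP; split; last by elra.
rewrite ltNge; apply/negP => t_le; apply: nf; exists t => //=; rewrite in_itv /=; elra.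
Qed.

(* The difference of the logarithms on the two sheets, in units of 2 pi. *)
Definition winding (b0 b1 : bool) z : Zd :=
  if near1 z then (b1%:R - b0%:R : int) else 0.

Lemma winding_near b0 b1 z : sheet b0 z -> sheet b1 z ->
  \forall w \near z, winding b0 b1 w = winding b0 b1 z.
Proof.
(* On a single sheet [near1] may jump, at the ends of the arc around 1; there the factor [b - b]
   makes the jump invisible. *)
have diag b : \forall w \near z, winding b b w = winding b b z.
  by near=> w; rewrite /winding !subrr !if_same.
case: b0; case: b1 => // s0 s1; rewrite /winding.
  by near=> w; rewrite (near (near1_near s1 s0) w).
by near=> w; rewrite (near (near1_near s0 s1) w).
Unshelve. all: by end_near. Qed.

Lemma winding_cocycle b0 b1 b2 z :
  winding b1 b2 z - winding b0 b2 z + winding b0 b1 z = 0.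
Proof.
rewrite /winding; case: ifP => _; rewrite ?subrr ?add0r//.
by case: b0; case: b1; case: b2.
Qed.

Definition winding_cover z : set T := sheet (sheet_of z).
Definition winding_cochain : cochain T Zd T 1 :=
  pair_cochain (fun p q => winding (sheet_of p) (sheet_of q)).

Lemma winding_cover_pointed : pointed_cover winding_cover.
Proof. by move=> z; split; [exact: sheet_open|exact: sheet_ofP]. Qed.

Lemma winding_is_cocycle : is_cocycle winding_cover winding_cochain.
Proof.
split.
  apply/is_cochainP => [z|s z sz]; first exact: sheet_open.
  by apply/continuous_near_cst/winding_near; [exact: (sz ord0)|exact: (sz ord_max)].
by move=> s z _; rewrite cobound_pair winding_cocycle.
Qed.
End Sheets.

(** * Integral cocycles on the circle and their sections over the line *)

Section IntegerCocycle.
Variables (X : topologicalType) (C : X -> set X) (c : cochain X Zd X 1).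
Hypotheses (pC : pointed_cover C) (cC : is_cocycle C c).

Definition transition p q z : Zd :=
  c (fun k : 'I_2 => if k == ord0 then p else q) z.

Lemma pair_transition : c = pair_cochain transition.
Proof.
apply/funext => s; apply/funext => z; rewrite /pair_cochain /transition.
by congr (c _ z); apply/funext => -[[|[|//]] lt_k] /=; congr s; exact: val_inj.
Qed.

Lemma transition_near p q z : C p z -> C q z ->
  \forall w \near z, transition p q w = transition p q z.
Proof.
move=> Cp Cq; apply/continuous_Zd_near.
move/(is_cochainP _ (pointed_cover_open pC)): cC.1; apply.
by move=> k; case: ifP.
Qed.

Lemma transition_trans p q r z : C p z -> C q z -> C r z ->
  transition p r z = transition p q z + transition q r z.
Proof.
move=> Cp Cq Cr; have := cC.2 (vtx3 p q r) z; rewrite pair_transition cobound_pair.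
rewrite /vtx3 /= inordK// => /(_ _)/eqP; rewrite -/(vtx3 p q r).
move/(_ (proj2 (overlap_vtx3 _ _ _ _ _) (And3 Cp Cq Cr))).
rewrite addrAC subr_eq0 => /eqP <-; exact: addrC.
Qed.

End IntegerCocycle.

Section LineLift.
Variables (R : realType) (C : circle R -> set (circle R)).
Variable c : cochain (circle R) Zd (circle R) 1.
Hypotheses (pC : pointed_cover C) (cC : is_cocycle C c).
Local Notation tr := (transition c).
Implicit Types (a b x y : R) (g : R -> Zd).

(* The transitions [c] glue a Z-torsor over the circle; [g] is a section over ]a, b[
   of its pullback to the line, where the value at x is read in the chart of index
   expi x. *)
Definition lifts_on g a b := forall x, a < x < b ->
  \forall y \near x, g y = g x + tr (expi x) (expi y) (expi y).

Lemma C_expi (x : R) : C (expi x) (expi x). Proof. by case: (pC (expi x)). Qed.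

Lemma C_expi_near p (x : R) : C p (expi x) -> \forall y \near x, C p (expi y).
Proof.
move=> Cp; apply: (@expi_continuous R x); apply: open_nbhs_nbhs; split=> //.
exact: pointed_cover_open.
Qed.

(** The section is the one equal to 0 in the chart of index [expi x]; it makes sense as long as
    [expi y] stays in [C (expi x)]. *)
Lemma lifts_local x : exists2 d, 0 < d & exists g, lifts_on g (x - d) (x + d).
Proof.
have /nbhs_ballP[d /= d_gt0 dC] := C_expi_near (C_expi x).
exists d => //; exists (fun y => tr (expi x) (expi y) (expi y)) => y yd.
have Cxy : C (expi x) (expi y).
  by apply: dC; rewrite /ball /= ltr_norml; move: yd => /andP[? ?]; apply/andP; split; lra.
have trn := expi_continuous (transition_near pC cC Cxy (C_expi y)).
near=> z.
rewrite (transition_trans cC (q := expi y)) //; first congr (_ + _).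
- by near: z; exact: trn.
- by near: z; exact: C_expi_near.
- by near: z; apply: C_expi_near; exact: C_expi.
- exact: C_expi.
Unshelve. all: by end_near. Qed.

Lemma lifts_onW g a b a' b' : a <= a' -> b' <= b ->
  lifts_on g a b -> lifts_on g a' b'.
Proof.
move=> aa' bb' gab x /andP[a'x xb']; apply: gab.
by rewrite (le_lt_trans aa' a'x) (lt_le_trans xb' bb').
Qed.

(** Sections may be shifted by a constant: adding [g1 y - g2 y] to the second one makes it agree
    with the first at [y], where the glued section switches. *)
Lemma lifts_glue g1 g2 a1 b1 a2 b2 y : a1 < y < b1 -> a2 < y < b2 ->
  lifts_on g1 a1 b1 -> lifts_on g2 a2 b2 -> exists g, lifts_on g a1 b2.
Proof.
move=> /andP[a1y yb1] /andP[a2y yb2] l1 l2.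
exists (fun w => if w <= y then g1 w else g2 w + (g1 y - g2 y)) => x /andP[a1x xb2].
have [xy|yx|->] := ltgtP x y.
- near=> z; have zy : z < y by near: z; apply: open_nbhs_nbhs; split; [exact: open_lt|].
  rewrite (ltW zy); by near: z; apply: l1; rewrite a1x (lt_trans xy).
- near=> z; have yz : y < z by near: z; apply: open_nbhs_nbhs; split; [exact: open_gt|].
  rewrite leNgt yz /= addrAC; congr (_ + _); by near: z; apply: l2; rewrite xb2 (lt_trans a2y).
near=> z; case: ifP => _.
  by near: z; apply: l1; rewrite a1y.
rewrite (_ : g2 z = g2 y + tr (expi y) (expi z) (expi z)); first by zmod_eq.
by near: z; apply: l2; rewrite a2y.
Unshelve. all: by end_near. Qed.

Lemma lifts_exist a b : a < b -> exists g, lifts_on g a b.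
Proof.
move=> ab; pose S := [set x | a < x <= b /\ exists g, lifts_on g a x].
(* Used at x = sup S: truncated at [b], the extended endpoint is still in [S], so the supremum is
   already [b] and the extended section covers the whole interval. *)
have S_min x d g : a < x -> 0 < d -> x <= b -> lifts_on g a (x + d) -> S (Num.min (x + d) b).
  move=> ax d_gt0 xb lg; split.
    by rewrite lt_min ab ge_min lexx orbT !andbT; lra.
  by exists g; apply: lifts_onW lg; rewrite ?ge_min ?lexx.
have S_sup : has_sup S.
  split; last by exists b => x [/andP[]].
  have [d d_gt0 [g lg]] := lifts_local a; exists (Num.min (a + d) b); split.
    by rewrite lt_min ab ge_min lexx orbT !andbT; lra.
  by exists g; apply: lifts_onW lg; rewrite ?ge_min ?lexx//; lra.
have [x0 Sx0] := S_sup.1.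
have as_ : a < sup S.
  by case: (Sx0) => /andP[ax0 _] _; apply: lt_le_trans ax0 _; exact: sup_upper_bound.
have sb : sup S <= b by apply: ge_sup; [exists x0|move=> x [/andP[]]].
have [d d_gt0 [g2 lg2]] := lifts_local (sup S).
have [x Sx dx] := sup_adherent d_gt0 S_sup.
have xs := sup_upper_bound S_sup Sx.
have [/andP[ax xb] [g1 lg1]] := Sx.
pose m := Num.max a (sup S - d).
have mx : m < x by rewrite gt_max ax.
have am : a <= m by rewrite le_max lexx.
have sm : sup S - d <= m by rewrite le_max lexx orbT.
(* The midpoint of [m] and [x] lies in both domains: below [x] for [g1], above [sup S - d] for
   [g2]. *)
have [|| g lg] := @lifts_glue g1 g2 a x (sup S - d) (sup S + d) ((m + x) / 2) _ _ lg1 lg2.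
- by apply/andP; split; lra.
- by apply/andP; split; lra.
have := sup_upper_bound S_sup (S_min _ _ _ as_ d_gt0 sb lg).
by rewrite ge_min => /orP[|bs]; [lra|exists g; apply: lifts_onW lg => //; lra].
Qed.

(** The points x and x + 2 pi lie over the same point of the circle, so the values of [g] there vary
    by the same transition and their difference is locally constant; the interval is connected. *)
Lemma lifts_monodromy g a b x0 : lifts_on g (a - 2 * pi) (b + 2 * pi) ->
  a < x0 < b -> forall x, a < x < b ->
  g (x + 2 * pi) - g x = g (x0 + 2 * pi) - g x0.
Proof.
move=> lg x0ab.
pose k x := g (x + 2 * pi) - g x.
have k_near x : a < x < b -> \forall y \near x, k y = k x.
  move=> /andP[ax xb]; have pi0 := pi_gt0 R.
  have n1 : \forall y \near x, g y = g x + tr (expi x) (expi y) (expi y).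
    by apply: lg; apply/andP; split; lra.
  have e2 z : expi (z + 2 * pi) = expi z by rewrite expiD expi2pi addr0.
  have sh : {for x, continuous (fun y : R => y + 2 * pi)}.
    by apply: continuousD; [move=> ?|exact: cst_continuous].
  have n2 : \forall y \near x, g (y + 2 * pi) =
      g (x + 2 * pi) + tr (expi (x + 2 * pi)) (expi (y + 2 * pi)) (expi (y + 2 * pi)).
    have x2 : a - 2 * pi < x + 2 * pi < b + 2 * pi by apply/andP; split; lra.
    exact: (sh _ (lg _ x2)).
  near=> y; rewrite /k (near n1 y)// (near n2 y)// !e2; zmod_eq.
have conn : connected `]a, b[%classic by exact/connected_intervalP/interval_is_interval.
have k_open P : open [set x | a < x < b /\ P (k x)].
  rewrite openE => x [xab Px]; near=> y; split.
    have : `]a, b[%classic y; last by rewrite /= in_itv.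
    near: y; apply: open_nbhs_nbhs; split; first exact: interval_open.
    by rewrite /= in_itv.
  by rewrite (near (k_near _ xab) y).
pose B := [set x | a < x < b /\ k x = k x0].
have BE : B = `]a, b[%classic.
  apply: conn; first by exists x0.
    exists B; first exact: (k_open (fun m => m = k x0)).
    by apply/seteqP; split=> x; [move=> [? ?]; split=> //=; rewrite in_itv|case].
  exists (~` [set x | a < x < b /\ k x <> k x0]).
    by apply: open_closedC; exact: (k_open (fun m => m <> k x0)).
  apply/seteqP; split=> x /=; first by move=> [xab kx]; rewrite in_itv; split=> // -[].
  by rewrite in_itv /= => -[xab nk]; split=> //; apply: contrapT => ?; apply: nk.
move=> x xab; have : B x by rewrite BE /= in_itv.
by case.
Unshelve. all: by end_near. Qed.

End LineLift.

(** * Multiples of a class, and the generator in degree 1 on the circle *)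

Section Multiples.
Variables (X : topologicalType) (A : topologicalZmodType) (U : X -> set X) (p : nat).
Hypothesis pU : pointed_cover U.
Implicit Types c d : cochain X A X p.

Lemma pointed_classD c d : is_cocycle U c -> is_cocycle U d ->
  pointed_class U c + pointed_class U d = pointed_class U (fun s x => c s x + d s x).
Proof.
move=> cc cd; have ccd := is_cocycleD cc cd.
rewrite !pointed_classE; rewrite [LHS]cech_add_pi; apply/cech_piP.
by apply: (cohomologousW pU) => // x z.
Qed.

Lemma pointed_classN c : is_cocycle U c ->
  - pointed_class U c = pointed_class U (fun s x => - c s x).
Proof.
move=> cc; have cNc := is_cocycleN cc; rewrite !pointed_classE.
rewrite [LHS]cech_opp_pi; apply/cech_piP.
by apply: (cohomologousW pU) => // x z.
Qed.

Lemma pointed_class0 : pointed_class U (fun _ _ => 0 : A) = 0 :> cech X A p.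
Proof.
rewrite (pointed_classE pU (@is_cocycle0 X A X U p)); apply/cech_piP.
by apply: (cohomologousW pU) => // x z.
Qed.

Lemma pointed_classMz c (m : int) : is_cocycle U c ->
  is_cocycle U (fun s x => c s x *~ m) /\
  pointed_class U c *~ m = pointed_class U (fun s x => c s x *~ m).
Proof.
move=> cc.
have posP n : is_cocycle U (fun s x => c s x *+ n) /\
    pointed_class U c *+ n = pointed_class U (fun s x => c s x *+ n).
  elim: n => [|n [cn IH]].
    by split; [exact: is_cocycle0|rewrite mulr0n -pointed_class0].
  have e : (fun s x => c s x *+ n.+1) = (fun s x => c s x + c s x *+ n).
    by apply/funext => s; apply/funext => x; rewrite mulrS.
  by rewrite e; split; [exact: is_cocycleD|rewrite mulrS IH pointed_classD].
case: m => n; first exact: posP.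
have [cn eqn] := posP n.+1; split; first exact: is_cocycleN.
by rewrite NegzE mulrNz -pmulrn eqn pointed_classN.
Qed.

End Multiples.

Section Generator.
Variables (R : realType) (eps : R).
Hypotheses (eps_gt0 : 0 < eps) (eps_small : eps < pi / 2).
Local Notation T := (circle R).

(** A change of sheet changes the logarithm only over the arc around 1, by 2 pi; the logarithm on
    the first sheet lies there in the interval where the monodromy is known to be [k]. *)
Lemma winding_jump (g : R -> Zd) (k : Zd) b0 b1 (z : T) :
  (forall x, - eps < x < eps -> g (x + 2 * pi) - g x = k) ->
  sheet eps b0 z -> sheet eps b1 z ->
  g (slog eps b1 z) = g (slog eps b0 z) + k *~ (winding eps b0 b1 z : int).
Proof.
move=> gk; have jump : sheet eps false z -> sheet eps true z ->
    g (slog eps true z) = g (slog eps false z) + (if near1 eps z then k else 0).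
  move=> s0 s1; rewrite (slog_near1 eps_gt0 eps_small s0 s1).
  case: ifP => n1; rewrite ?addr0//.
  have [l0 _] := slogP s0; have [l1 _] := slogP s1.
  rewrite (slog_near1 eps_gt0 eps_small s0 s1) n1 in l1.
  set l := slog _ _ _ in l0 l1 *; have l_in : - eps < l < eps.
    by move: l0 l1; rewrite /sheet_lo /sheet_hi => /andP[? ?] /andP[? ?]; apply/andP; split; lra.
  by rewrite -(gk l l_in) [RHS]addrC subrK.
rewrite /winding; case: b0; case: b1 => s0 s1; rewrite ?subrr ?if_same ?mulr0z ?addr0//.
  rewrite (jump s1 s0); case: ifP => _; rewrite ?mulr0z ?addr0//.
  by rewrite mulrN1z addrK.
by rewrite (jump s0 s1); case: ifP => _; rewrite ?mulr0z// subr0 mulr1z.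
Qed.

Lemma winding_generates :
  generates (pointed_class (winding_cover eps) (winding_cochain eps)).
Proof.
move=> x; set C := ccov (repr x); set c := cfun (repr x).
have pC : pointed_cover C := ccov_pointed _.
have cC : is_cocycle C c := ccocycle _.
have pW := winding_cover_pointed eps_gt0 eps_small.
have cW := winding_is_cocycle eps_gt0 eps_small.
have pi0 := pi_gt0 R; have e0 := eps_gt0; have e1 := eps_small.
(* The interval contains the logarithms of both sheets, and leaves around ]-eps, eps[ the margins of
   2 pi that [lifts_monodromy] requires. *)
have [g lg] := @lifts_exist R C c pC cC (- eps - 2 * pi) (eps + 2 * pi) ltac:(lra).
pose k := g (0 + 2 * pi) - g 0.
have gk y : - eps < y < eps -> g (y + 2 * pi) - g y = k.
  by move=> y_eps; apply: (lifts_monodromy lg _ y_eps); apply/andP; split; lra.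
exists (- (k : int)); have [cWk ->] := pointed_classMz pW (- (k : int)) cW.
rewrite -[x]pointed_class_repr -/C -/c; apply/pointed_classP => //.
exists (meet_cover C (winding_cover eps)); split.
- exact: meet_pointed.
- by move=> z w [].
- by move=> z w [].
(* The section in the chart of index [t]: at a logarithm of [z], [g] is read in the chart of index
   [z], and the transition carries it to [t]. The coboundary of [b] is [c] plus [k] times the
   winding cocycle. *)
pose b (t z : T) : Zd := g (slog eps (sheet_of eps t) z) + transition c z t z.
exists (fun s => b (s ord0)); split.
  apply/is_cochainP => [|s z sz].
    exact/pointed_cover_open/meet_pointed.
  have [Cz Sz] := sz ord0; set t := s ord0 in Cz Sz *.
  apply: continuous_near_cst.
  have lz := slog_continuous eps_gt0 eps_small Sz.
  have [lz_in lzE] := slogP Sz.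
  have l_in : - eps - 2 * pi < slog eps (sheet_of eps t) z < eps + 2 * pi.
    by move: lz_in; rewrite /sheet_lo /sheet_hi; case: (sheet_of _ _) => /andP[? ?];
      apply/andP; split; lra.
  pose glP w := g (slog eps (sheet_of eps t) w) = g (slog eps (sheet_of eps t) z) +
    transition c (expi (slog eps (sheet_of eps t) z)) (expi (slog eps (sheet_of eps t) w))
      (expi (slog eps (sheet_of eps t) w)).
  have gl : \forall w \near z, glP w := lz _ (lg _ l_in).
  have Czz : C z z by case: (pC z).
  have tn := transition_near pC cC Czz Cz.
  have nC p : C p z -> \forall w \near z, C p w.
    by move=> Cpz; apply: open_nbhs_nbhs; split=> //; exact: pointed_cover_open.
  have nS : \forall w \near z, sheet eps (sheet_of eps t) w.
    by apply: open_nbhs_nbhs; split=> //; exact: sheet_open.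
  near=> w; have [] : [/\ C z w, C t w & C w w].
    by split; [near: w; exact: nC|near: w; exact: nC|case: (pC w)].
  move=> Czw Ctw Cww; have lwE : expi (slog eps (sheet_of eps t) w) = w.
    by have /slogP[] : sheet eps (sheet_of eps t) w by near: w.
  have glw : glP w by near: w.
  (* The chart in which [g] is read moves with [w], but the transitions from [z] to [w] and from [w]
     to [t] compose to the one from [z] to [t], which is locally constant. *)
  rewrite /b glw lzE lwE -addrA.
  by rewrite -(transition_trans cC Czw Cww Ctw) (near tn w).
move=> s z sz; rewrite cobound0E (pair_transition c) /pair_cochain.
have [C0 S0] := sz ord0; have [C1 S1] := sz ord_max.
have Czz : C z z by case: (pC z).
rewrite /b (winding_jump gk S0 S1) (transition_trans cC Czz C0 C1).
rewrite /winding_cochain /pair_cochain mulrNz !Zd_mulrz (mulrC k).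
set w := _ * k; set g0 := g _; set t0 := transition c z _ z; zmod_eq.
Unshelve. all: by end_near. Qed.

End Generator.

(** * The Fock space *)

Section HilbertLemmas.
Variable R : realType.
Local Notation C := (Cx R).
Variables (F : completeNormedModType C) (dotF : {dot F for Num.conj}).
Hypothesis hilF : hilbert dotF.

Lemma cspan_sub (A : set F) v : A v -> cspan A v.
Proof.
move=> Av; apply: subset_closure; exists 1%N, (fun=> 1), (fun=> v); split=> //.
by rewrite big_ord1 scale1r.
Qed.

Lemma cspan_approx (A : set F) v (e : C) : cspan A v -> 0 < e ->
  exists n (c : 'I_n -> C) (w : 'I_n -> F),
    (forall i, A (w i)) /\ `|v - \sum_i c i *: w i| < e.
Proof.
move=> Av e_gt0; have [_ [[n [c [w [Aw ->]]]] vw]] := Av _ (nbhsx_ballx v e e_gt0).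
by exists n, c, w; split=> //; move: vw; rewrite -ball_normE.
Qed.

Lemma linZ (W : {linear F -> F}) c v : W (c *: v) = c *: W v.
Proof. exact: linearZ_LR. Qed.

Lemma linB (W : {linear F -> F}) v w : W (v - w) = W v - W w.
Proof. exact: raddfB. Qed.

Lemma unitary_norm (W : F -> F) : unitary dotF W -> forall v, `|W v| = `|v|.
Proof.
move=> [_ Wip _] v; apply/eqP; rewrite -(@eqrXn2 _ 2)//; apply/eqP.
by rewrite !hilF; exact: Wip.
Qed.

Lemma unitary_comp (W W' : F -> F) : unitary dotF W -> unitary dotF W' ->
  unitary dotF (W \o W').
Proof.
move=> [Wlin Wip Wsurj] [Wlin' Wip' Wsurj']; split.
- by move=> c v w /=; rewrite Wlin' Wlin.
- by move=> v w /=; rewrite Wip Wip'.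
- by move=> w; have [v <-] := Wsurj w; have [v' <-] := Wsurj' v; exists v'.
Qed.

Lemma unitary_inv (W W' : F -> F) : unitary dotF W -> cancel W W' -> cancel W' W ->
  unitary dotF W'.
Proof.
move=> [Wlin Wip Wsurj] WK W'K; split.
- by move=> c v w; apply: (can_inj WK); rewrite W'K Wlin !W'K.
- by move=> v w; rewrite -Wip !W'K.
- by move=> w; exists (W w).
Qed.

Lemma unitary_continuous (W : {linear F -> F}) : unitary dotF W -> continuous W.
Proof.
move=> uW v; apply/(@cvgrPdist_lt _ _ _ (nbhs v)) => e e_gt0; near=> w.
rewrite -linB (unitary_norm uW); near: w; exact: cvgr_dist_lt.
Unshelve. all: by end_near. Qed.

(** Replacing [v] by its difference with a combination [s] of vectors of [A] does not change the
    defect [W v - k *: W' v]. Both maps are isometries, so the defect has norm at most twice the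
    distance from [v] to [s]. *)
Lemma unitary_eq (A : set F) (W W' : {linear F -> F}) (k : C) :
  cspan A = setT -> unitary dotF W -> unitary dotF W' -> `|k| = 1 ->
  (forall v, A v -> W v = k *: W' v) -> forall v, W v = k *: W' v.
Proof.
move=> spanA uW uW' k1 WW' v; apply/eqP; rewrite -subr_eq0 -normr_eq0.
apply: contraT => n_neq0; set e := `|_| in n_neq0.
have e_gt0 : 0 < e by rewrite lt0r n_neq0 normr_ge0.
have e2_gt0 : 0 < e / 2 by rewrite divr_gt0.
have [|n [c [w [Aw vw]]]] := @cspan_approx A v (e / 2) _ e2_gt0.
  by rewrite spanA.
have : W (\sum_i c i *: w i) = k *: W' (\sum_i c i *: w i).
  rewrite (linear_sum W) (linear_sum W') scaler_sumr; apply: eq_bigr => i _.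
  by rewrite (linZ W) (linZ W') WW'// !scalerA mulrC.
set s := \sum_i _ in vw *; move=> Ws.
have : e < e.
  rewrite {1}/e (_ : W v - k *: W' v = W (v - s) - k *: W' (v - s)); last first.
    rewrite (linB W) (linB W') scalerBr Ws; set t := k *: W' s.
    by set t' := k *: W' v; zmod_eq.
  rewrite (le_lt_trans (ler_normB _ _))// normrZ k1 mul1r (unitary_norm uW) (unitary_norm uW').
  by rewrite [ltRHS](splitr e) ltrD.
by rewrite ltxx.
Qed.

End HilbertLemmas.

(** * Charge on the Fock space *)

Section FockLemmas.
Variable R : realType.
Local Notation C := (Cx R).
Variables (H F : completeNormedModType C).
Variables (dotH : {dot H for Num.conj}) (dotF : {dot F for Num.conj}).
Hypothesis hilF : hilbert dotF.
Variables (u : int -> H) (Hp Hm : set H).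
Hypothesis polH : polarization dotH u Hp Hm.
Variables (a astar : H -> {linear F -> F}) (vac : F).
Hypothesis fockF : fock_space dotH dotF u Hp Hm a astar vac.

(** The algebraic counterpart of [charge_space], without closure, so that [a] and [astar] can be
    followed by induction on finite words with no appeal to continuity. *)
Inductive fock_span : int -> F -> Prop :=
| fock_span0 k : fock_span k 0
| fock_spanP k c v w : fock_span k v -> fock_span k w -> fock_span k (c *: v + w)
| fock_span_vector ms ps : fock_indices ms ps ->
    fock_span ((size ps)%:Z - (size ms)%:Z) (fock_vector u a astar vac ms ps).

Local Notation fockv := (fock_vector u a astar vac).

Lemma fock_spanD k v w : fock_span k v -> fock_span k w -> fock_span k (v + w).
Proof. by move=> sv sw; rewrite -[v]scale1r; exact: fock_spanP. Qed.

Lemma fock_spanZ k c v : fock_span k v -> fock_span k (c *: v).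
Proof. by move=> sv; rewrite -[_ *: _]addr0; apply: fock_spanP => //; exact: fock_span0. Qed.

Lemma fock_spanN k v : fock_span k v -> fock_span k (- v).
Proof. by move=> sv; rewrite -scaleN1r; exact: fock_spanZ. Qed.

Lemma fock_span_linear (A : {linear F -> F}) d :
  (forall ms ps, fock_indices ms ps ->
     fock_span ((size ps)%:Z - (size ms)%:Z + d) (A (fockv ms ps))) ->
  forall k v, fock_span k v -> fock_span (k + d) (A v).
Proof.
move=> Av k v; elim=> {k v} [k|k c v w _ IHv _ IHw|ms ps /Av//].
  by rewrite linear0; exact: fock_span0.
by rewrite linearP; exact: fock_spanP.
Qed.

Let CAR : CAR_representation dotH dotF a astar. Proof. by case: fockF. Qed.

Lemma annihilate_vac i : 0 <= i -> a (u i) vac = 0.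
Proof.
move=> i_ge0; case: fockF => _ _ _ /(_ (u i)) [+ _] _; apply.
by case: polH => _ -> _ _; apply: cspan_sub; exists i.
Qed.

Lemma create_vac i : i < 0 -> astar (u i) vac = 0.
Proof.
move=> i_lt0; case: fockF => _ _ _ /(_ (u i)) [_ +] _; apply.
by case: polH => _ _ -> _; apply: cspan_sub; exists i.
Qed.

Lemma dot_eq0 v : (forall w, dotF v w = 0) -> v = 0.
Proof. by move=> v0; apply/eqP; rewrite -(dnorm_eq0 dotF) v0. Qed.

Lemma aaC f g v : a f (a g v) = - a g (a f v).
Proof. by apply/eqP; rewrite -addr_eq0; case: CAR => _ _ -> _. Qed.

(** Adjoint of [aaC]: the sum of the two sides is orthogonal to every vector. *)
Lemma astarC f g v : astar f (astar g v) = - astar g (astar f v).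
Proof.
apply/eqP; rewrite -addr_eq0; apply/eqP/dot_eq0 => w.
have adj f' v' w' : dotF (astar f' v') w' = dotF v' (a f' w').
  by case: CAR => _ + _ _ => /(_ f' w' v'); rewrite /ip => <-.
by rewrite linearDl /= !adj -linearDr /= (aaC f g) subrr linear0r.
Qed.

Lemma a_astar i j v : a (u i) (astar (u j) v) = (i == j)%:R *: v - astar (u j) (a (u i) v).
Proof.
apply/eqP; rewrite eq_sym subr_eq eq_sym; apply/eqP.
by case: CAR => _ _ _ ->; case: polH => -> _ _ _.
Qed.

Lemma astar_a i j v : astar (u i) (a (u j) v) = (i == j)%:R *: v - a (u j) (astar (u i) v).
Proof. by rewrite a_astar eq_sym opprB addrC subrK. Qed.

Lemma fock_span_a_neg i k v : i < 0 -> fock_span k v -> fock_span (k - 1) (a (u i) v).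
Proof.
move=> i_lt0; apply: fock_span_linear => ms ps mps.
have /fock_span_vector : fock_indices (i :: ms) ps by rewrite /fock_indices /= i_lt0.
by congr fock_span; rewrite /= -addn1 PoszD opprD addrA.
Qed.

(** Since m < 0 <= i for each factor [a (u m)], the operator passes these factors with no
    contraction, only a sign, and joins the factors [astar]. *)
Lemma fock_span_astar_nneg i k v : 0 <= i -> fock_span k v ->
  fock_span (k + 1) (astar (u i) v).
Proof.
move=> i_ge0; apply: fock_span_linear => ms ps; elim: ms => [|m ms IH] mps.
  have /fock_span_vector : fock_indices [::] (i :: ps).
    by move: mps; rewrite /fock_indices /= i_ge0.
  by congr fock_span; rewrite /= -addn1 PoszD addrAC.
have [m_lt0 {}mps] : m < 0 /\ fock_indices ms ps.
  by move: mps; rewrite /fock_indices /= => /andP[/andP[-> ->] ->].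
rewrite /= astar_a (_ : (i == m) = false) ?scale0r ?sub0r; last first.
  by apply: contraTF m_lt0 => /eqP <-; rewrite -leNgt.
have := fock_spanN (fock_span_a_neg m_lt0 (IH mps)).
by congr fock_span; rewrite -addn1 PoszD; ring.
Qed.

(** For i >= 0 the operator is not an allowed factor: it is moved to the vacuum, which it kills, and
    each contraction on the way removes one factor [astar], leaving the expected charge. *)
Lemma fock_span_a i k v : fock_span k v -> fock_span (k - 1) (a (u i) v).
Proof.
have [i_ge0|] := leP 0 i; last exact: fock_span_a_neg.
apply: fock_span_linear => ms ps; elim: ms => [|m ms IH] mps.
  elim: ps mps => [|p ps IH] mps; first by rewrite /= annihilate_vac//; exact: fock_span0.
  have [p_ge0 {}mps] : 0 <= p /\ fock_indices [::] ps.
    by move: mps; rewrite /fock_indices /= => /andP[].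
  rewrite /= a_astar; apply: fock_spanD.
    have := fock_spanZ (i == p)%:R (fock_span_vector mps).
    by congr fock_span; rewrite /= -addn1 PoszD; ring.
  have := fock_spanN (fock_span_astar_nneg p_ge0 (IH mps)).
  by congr fock_span; rewrite /= -addn1 PoszD; ring.
have [m_lt0 {}mps] : m < 0 /\ fock_indices ms ps.
  by move: mps; rewrite /fock_indices /= => /andP[/andP[-> ->] ->].
rewrite /= aaC; have := fock_spanN (fock_span_a_neg m_lt0 (IH mps)).
by congr fock_span; rewrite -addn1 PoszD; ring.
Qed.

Lemma fock_span_astar i k v : fock_span k v -> fock_span (k + 1) (astar (u i) v).
Proof.
have [|i_lt0] := leP 0 i; first exact: fock_span_astar_nneg.
apply: fock_span_linear => ms ps; elim: ms => [|m ms IH] mps.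
  elim: ps mps => [|p ps IH] mps; first by rewrite /= create_vac//; exact: fock_span0.
  have [p_ge0 {}mps] : 0 <= p /\ fock_indices [::] ps.
    by move: mps; rewrite /fock_indices /= => /andP[].
  rewrite /= astarC; have := fock_spanN (fock_span_astar_nneg p_ge0 (IH mps)).
  by congr fock_span; rewrite /= -addn1 PoszD; ring.
have [m_lt0 {}mps] : m < 0 /\ fock_indices ms ps.
  by move: mps; rewrite /fock_indices /= => /andP[/andP[-> ->] ->].
rewrite /= astar_a; apply: fock_spanD.
  have := fock_spanZ (i == m)%:R (fock_span_vector mps).
  by congr fock_span; rewrite /= -addn1 PoszD; ring.
have := fock_spanN (fock_span_a_neg m_lt0 (IH mps)).
by congr fock_span; rewrite -addn1 PoszD; ring.
Qed.

Variables (hN : circle R -> {linear F -> F}) (S Sinv : {linear F -> F}).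
Hypothesis hNP : charge_power dotF u a astar vac hN.
Hypothesis SP : fock_shift dotF u a astar vac S Sinv.

Lemma hN_unitary z : unitary dotF (hN z). Proof. by case: (hNP z). Qed.

Lemma hN_span z k v : fock_span k v -> hN z v = cval z ^ k *: v.
Proof.
elim=> {k v} [k|k c v w _ IHv _ IHw|ms ps mps].
- by rewrite linear0 scaler0.
- by rewrite linearP IHv IHw scalerDr !scalerA mulrC.
by case: (hNP z) => _; apply; apply: cspan_sub; exists ms, ps.
Qed.

(** [S] moves through the word one factor at a time, shifting each index, and its value on the
    vacuum supplies the extra unit of charge. *)
Lemma S_span k v : fock_span k v -> fock_span (k + 1) (S v).
Proof.
case: SP => _ [SK SinvK] Svac Sconj.
have Sa i w : S (a (u i) w) = a (u (i + 1)) (S w).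
  by rewrite -[in LHS](SK w); case: (Sconj i (S w)).
have Sastar i w : S (astar (u i) w) = astar (u (i + 1)) (S w).
  by rewrite -[in LHS](SK w); case: (Sconj i (S w)).
apply: fock_span_linear => ms ps; elim: ms => [|m ms IH] mps.
  elim: ps mps => [|p ps IH] mps.
    have /fock_span_vector : fock_indices [::] [:: 0] by [].
    by rewrite /= Svac.
  have {}mps : fock_indices [::] ps.
    by move: mps; rewrite /fock_indices /= => /andP[].
  rewrite /= Sastar; have := fock_span_astar (p + 1) (IH mps).
  by congr fock_span; rewrite /= -addn1 PoszD; ring.
have {}mps : fock_indices ms ps.
  by move: mps; rewrite /fock_indices /= => /andP[/andP[_ ->] ->].
rewrite /= Sa; have := fock_span_a (m + 1) (IH mps).
by congr fock_span; rewrite -addn1 PoszD; ring.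
Qed.

Let fock_vectors : set F :=
  [set v | exists ms ps, fock_indices ms ps /\ v = fockv ms ps].

Let fock_dense : cspan fock_vectors = setT. Proof. by case: fockF. Qed.

(* S raises the charge by one. *)
Lemma hN_S z v : hN z (S v) = cval z *: S (hN z v).
Proof.
have uS : unitary dotF S by case: SP.
have := @unitary_eq _ _ _ hilF fock_vectors (hN z \o S) (S \o hN z) (cval z) fock_dense.
apply; rewrite ?cval_norm//; [exact: unitary_comp (hN_unitary z) uS
  |exact: unitary_comp uS (hN_unitary z)|].
move=> _ [ms [ps [mps ->]]] /=.
have sv := fock_span_vector mps.
rewrite (hN_span _ sv) (hN_span _ (S_span sv)) (linZ S) scalerA.
by rewrite expfzDr ?cval_neq0// expr1z mulrC.
Qed.

Lemma hN_add z w v : hN (z + w) v = hN z (hN w v).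
Proof.
rewrite -[RHS]scale1r.
have := @unitary_eq _ _ _ hilF fock_vectors (hN (z + w)) (hN z \o hN w) 1 fock_dense.
apply; rewrite ?normr1//; [exact: hN_unitary
  |exact: unitary_comp (hN_unitary z) (hN_unitary w)|].
move=> _ [ms [ps [mps ->]]] /=.
have sv := fock_span_vector mps.
by rewrite scale1r !(hN_span _ sv) (linZ (hN z)) (hN_span _ sv) scalerA cvalD expfzMl mulrC.
Qed.

Lemma hN_Sinv z v : hN z (Sinv v) = (cval z)^-1 *: Sinv (hN z v).
Proof.
case: SP => _ [SK SinvK] _ _.
apply: (can_inj SK); rewrite (linZ S) SinvK -[in RHS](SinvK v) hN_S.
by rewrite scalerA mulVf ?cval_neq0// scale1r.
Qed.

Lemma cvalMz (z : circle R) (k : int) : cval (z *~ k) = cval z ^ k.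
Proof.
have cvalMn n : cval (z *+ n) = cval z ^+ n.
  by elim: n => [|n IH]; rewrite ?mulr0n// mulrS cvalD IH exprS.
by case: k => n; [exact: cvalMn|rewrite NegzE mulrNz -pmulrn -exprnN -cvalMn].
Qed.

(** On a Fock vector the operator is multiplication by a fixed power of [z]. All the [hN z] are
    isometries, so three errors of e / 3 carry continuity over to limits of combinations of Fock
    vectors. *)
Lemma hN_continuous v : continuous (fun z => hN z v).
Proof.
move=> z0; apply/(@cvgrPdist_lt _ _ _ (nbhs z0)) => e e_gt0.
have e3_gt0 : 0 < e / 3 by rewrite divr_gt0.
have [|n [c [w [fw vw]]]] := @cspan_approx _ _ fock_vectors v (e / 3) _ e3_gt0.
  by rewrite fock_dense.
set s := \sum_i _ in vw.
have cs : {for z0, continuous (fun z => hN z s)}.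
  rewrite (_ : (fun z => _) = (fun z => \sum_i c i *: hN z (w i))); last first.
    by apply/funext => z; rewrite linear_sum; apply: eq_bigr => i _; rewrite (linZ (hN z)).
  apply: continuous_zmod_sum => i; apply: continuousZ; first exact: cst_continuous.
  have [ms [ps [mps ->]]] := fw i; set k := (size ps)%:Z - (size ms)%:Z.
  rewrite (_ : (fun z => _) = (fun z => cval (z *~ k) *: fockv ms ps)); last first.
    by apply/funext => z; rewrite (hN_span _ (fock_span_vector mps)) cvalMz.
  apply: continuousZ; last exact: cst_continuous.
  apply: (@continuous_comp_at _ _ _ (fun z => z *~ k) (@cval R)); last exact: cval_continuous.
  by apply: (@continuous_zmodMz _ _ id) => U.
near=> z.
rewrite (_ : hN z0 v - hN z v =
  hN z0 (v - s) + (hN z0 s - hN z s) - hN z (v - s)); last first.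
  by rewrite (linB (hN z0)) (linB (hN z)); zmod_eq.
rewrite (le_lt_trans (ler_normB _ _))// (_ : e = e / 3 + e / 3 + e / 3); last by field.
rewrite ltrD//; last by rewrite (unitary_norm hilF (hN_unitary z)).
rewrite (le_lt_trans (ler_normD _ _))// ltrD//.
  by rewrite (unitary_norm hilF (hN_unitary z0)).
by near: z; apply: (@cvgr_dist_lt _ _ _ (nbhs z0) _ _ _ cs).
Unshelve. all: by end_near. Qed.

End FockLemmas.

(** * The projective Fock bundle *)

Lemma open_setX (X X' : topologicalType) (A : set X) (B : set X') :
  open A -> open B -> open (A `*` B).
Proof.
move=> oA oB; rewrite openE => -[x y] [/= Ax By]; exists (A, B) => //=.
by split; exact: open_nbhs_nbhs.
Qed.

(** * Transition functions of the line bundle *)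

Section TransitionFunctions.
Variables (R : realType) (Y : topologicalType) (L : line_family R Y).
Hypothesis lineL : is_line_bundle L.
Variables (I : Type) (V : I -> set Y) (oV : forall i, open (V i)).
Variables (phi : I -> Y * Cx R -> lb_total L) (psi : I -> lb_total L -> Cx R).
Hypothesis trivL : forall i, trivialization (V i) (phi i) (psi i).
Variable h : I -> I -> Y -> circle R.
Hypothesis transL : transition_functions V phi h.

Lemma psi_phi i y c : V i y -> psi i (phi i (y, c)) = c.
Proof. by move=> Vy; case: (trivL i) => _ _ /(_ y c Vy)[]. Qed.

Lemma transition_fun_trans i j k y : V i y -> V j y -> V k y ->
  h i k y = h i j y + h j k y.
Proof.
move=> Vi Vj Vk; apply: cval_inj; rewrite cvalD.
have e := transL 1 Vi Vk; rewrite (transL 1 Vj Vk) (transL _ Vi Vj) !mulr1 in e.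
by have := congr1 (psi i) e; rewrite !psi_phi.
Qed.

Lemma transition_fun_continuous i j y : V i y -> V j y ->
  {for y, continuous (h i j)}.
Proof.
move=> Vi Vj; apply: continuous_circle.
(* The unit vector of chart [j], read in chart [i], is the transition function. *)
apply: (@continuous_near _ _ (fun y => psi i (phi j (y, 1)))).
  have nV k : V k y -> \forall z \near y, V k z by move=> ?; exact: open_nbhs_nbhs.
  near=> z; have [Viz Vjz] : V i z /\ V j z by split; near: z; exact: nV.
  by rewrite (transL 1 Viz Vjz) psi_phi// mulr1.
have [cphi _ projphi _ _] := trivL j; have [_ cpsi _ _ _] := trivL i.
apply: continuous_comp_at.
  apply: (@continuous_comp_at Y (Y * Cx R)%type _ (fun z => (z, 1)) (phi j)).
    have c1 : {for y, continuous (fun z : Y => z)} by move=> U.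
    have c2 : {for y, continuous (fun=> 1 : Cx R)} by exact: cst_continuous.
    exact: (cvg_pair c1 c2).
  move: cphi; rewrite continuous_open_subspace; last exact/open_setX/openT.
  by apply; rewrite inE.
move: cpsi; rewrite continuous_open_subspace; last first.
  by move/continuousP: lineL.1; apply.
by apply; rewrite inE /=; case: (projphi y 1 Vj) => ->.
Unshelve. all: by end_near. Qed.

End TransitionFunctions.

(** * The Dixmier-Douady cocycle in closed form *)

Section DixmierDouadyCochain.
Variables (R : realType) (eps : R) (eps_gt0 : 0 < eps) (eps_small : eps < pi / 2).
Variables (Y : topologicalType) (n : nat) (V : 'I_n -> set Y).
Hypothesis oV : forall i, open (V i).
Variable h : 'I_n -> 'I_n -> Y -> circle R.
Hypothesis h_trans : forall i j k y, V i y -> V j y -> V k y ->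
  h i k y = h i j y + h j k y.
Hypothesis h_cont : forall i j y, V i y -> V j y -> {for y, continuous (h i j)}.
Local Notation J := ('I_n + 'I_n)%type.
Local Notation X := (circle R * Y)%type.
Local Notation U := (PF_cover V eps).
Implicit Types (i j k : J) (x : X).

Definition base i : 'I_n := match i with inl i | inr i => i end.
Definition side i : bool := if i is inr _ then true else false.

Lemma PF_coverE i : U i = sheet eps (side i) `*` V (base i).
Proof. by case: i. Qed.

Lemma PF_cover_open i : open (U i).
Proof. by rewrite PF_coverE; apply: open_setX => //; exact: sheet_open. Qed.

Definition PF_winding i j x : Zd := winding eps (side i) (side j) x.1.
Definition PF_transition i j x : circle R := h (base i) (base j) x.2.

(* The scalar between the lifts S^-1 h_ij^N and h_ij^N S^-1.  Lifting by the latter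
   would give exactly the cocycle h_jk^(- w_ij) with w the winding cochain, so the
   actual one differs from it by the coboundary of this scalar. *)
Definition PF_gauge i j x : circle R :=
  if [&& near1 eps x.1, side i & ~~ side j] then PF_transition i j x else 0.

Definition PF_cocycle : cochain X (circle R) J 2 := fun s x =>
  - cup1 (pair_cochain PF_winding) (pair_cochain PF_transition) s x
  + cobound (pair_cochain PF_gauge) s x.

Lemma PF_cocycleE s x (i := s ord0) (j := s (inord 1)) (k := s ord_max) :
  PF_cocycle s x = - (PF_transition j k x *~ (PF_winding i j x : int)) +
    (PF_gauge j k x - PF_gauge i k x + PF_gauge i j x).
Proof.
rewrite /PF_cocycle cobound_pair /cup1 {1 2}/pair_cochain edge0 edge_max /=.
have -> : lift ord0 ord0 = inord 1 :> 'I_3 by apply: val_inj; rewrite /= inordK.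
by have -> : lift ord0 ord_max = ord_max :> 'I_3 by apply: val_inj.
Qed.

Lemma continuous_fst (z : X) : {for z, continuous (fun x : X => x.1)}.
Proof. exact: cvg_fst. Qed.

Lemma continuous_snd (z : X) : {for z, continuous (fun x : X => x.2)}.
Proof. exact: cvg_snd. Qed.

Lemma PF_winding_is_cocycle : is_cocycle U (pair_cochain PF_winding).
Proof.
split.
  apply/is_cochainP => [|s x Ux]; first exact: PF_cover_open.
  have := Ux ord0; have := Ux ord_max; rewrite !PF_coverE => -[/= s1 _] [/= s0 _].
  apply: continuous_comp_at; first exact: continuous_fst.
  exact/continuous_near_cst/winding_near.
by move=> s x _; rewrite cobound_pair winding_cocycle.
Qed.

Lemma PF_transition_is_cocycle : is_cocycle U (pair_cochain PF_transition).
Proof.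
split.
  apply/is_cochainP => [|s x Ux]; first exact: PF_cover_open.
  have := Ux ord0; have := Ux ord_max; rewrite !PF_coverE => -[/= _ v1] [/= _ v0].
  by apply: continuous_comp_at; [exact: continuous_snd|exact: h_cont].
move=> s x Ux; rewrite cobound_pair /PF_transition.
have := Ux ord0; have := Ux (inord 1); have := Ux ord_max.
rewrite !PF_coverE => -[/= _ v2] [/= _ v1] [/= _ v0].
by rewrite (h_trans v0 v1 v2); zmod_eq.
Qed.

Lemma PF_gauge_is_cochain : is_cochain U (pair_cochain PF_gauge).
Proof.
apply/is_cochainP => [|s x Ux]; first exact: PF_cover_open.
have tc : {for x, continuous (PF_transition (s ord0) (s ord_max))}.
  by move/(is_cochainP _ PF_cover_open): PF_transition_is_cocycle.1 => /(_ s x Ux).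
have := Ux ord0; have := Ux ord_max; rewrite !PF_coverE => -[/= s1 _] [/= s0 _].
rewrite /pair_cochain /PF_gauge; case: (side (s ord0)) s0 => s0; last first.
  rewrite (_ : (fun=> _) = (fun=> 0)); first exact: cst_continuous.
  by apply/funext => y; rewrite andbF.
case: (side (s ord_max)) s1 => s1.
  rewrite (_ : (fun=> _) = (fun=> 0)); first exact: cst_continuous.
  by apply/funext => y; rewrite !andbF.
(* Where the two sheets meet, the arc containing the point is locally constant, so the gauge is
   locally the transition function or locally 0. *)
have n1 := continuous_fst (near1_near eps_gt0 eps_small s1 s0).
case: (boolP (near1 eps x.1)) => x1.
  apply: continuous_near tc; near=> y.
  have -> : near1 eps y.1 = near1 eps x.1 by near: y; exact: n1.
  by rewrite x1.
apply: continuous_near_cst; near=> y.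
have -> : near1 eps y.1 = near1 eps x.1 by near: y; exact: n1.
by rewrite (negPf x1).
Unshelve. all: by end_near. Qed.

Lemma PF_cocycle_is_cocycle : is_cocycle U PF_cocycle.
Proof.
apply: is_cocycleD.
  apply/is_cocycleN/is_cocycle_cup1; [exact: PF_cover_open|exact: PF_winding_is_cocycle|].
  exact: PF_transition_is_cocycle.
split; last by move=> s x _; exact: cobound_cobound_pair.
have /(is_cochainP _ PF_cover_open) cb := PF_gauge_is_cochain.
apply/is_cochainP => [|s x Ux]; first exact: PF_cover_open.
rewrite (_ : cobound _ s = fun x => pair_cochain PF_gauge (s \o lift (inord 0)) x -
  pair_cochain PF_gauge (s \o lift (inord 1)) x +
  pair_cochain PF_gauge (s \o lift (inord 2)) x); last first.
  by apply/funext => y; rewrite cobound1E.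
apply: continuous_zmodD; first (apply: continuous_zmodD; last apply: continuous_zmodN).
all: by apply: cb => m; exact: Ux.
Qed.

End DixmierDouadyCochain.

(** * Unitary lifts of the projective cocycle *)

Section ProjectiveFockBundle.
Variables (R : realType) (eps : R) (eps_gt0 : 0 < eps) (eps_small : eps < pi / 2).
Variables (H F : completeNormedModType (Cx R)).
Variables (dotH : {dot H for Num.conj}) (dotF : {dot F for Num.conj}).
Hypothesis hilF : hilbert dotF.
Variables (u : int -> H) (Hp Hm : set H) (polH : polarization dotH u Hp Hm).
Variables (a astar : H -> {linear F -> F}) (vac : F).
Hypothesis fockF : fock_space dotH dotF u Hp Hm a astar vac.
Variables (hN : circle R -> {linear F -> F}) (S Sinv : {linear F -> F}).
Hypothesis hNP : charge_power dotF u a astar vac hN.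
Hypothesis SP : fock_shift dotF u a astar vac S Sinv.
Variables (Y : topologicalType) (n : nat) (V : 'I_n -> set Y).
Hypothesis oV : forall i, open (V i).
Variable h : 'I_n -> 'I_n -> Y -> circle R.
Hypothesis h_trans : forall i j k y, V i y -> V j y -> V k y ->
  h i k y = h i j y + h j k y.
Hypothesis h_cont : forall i j y, V i y -> V j y -> {for y, continuous (h i j)}.
Local Notation J := ('I_n + 'I_n)%type.
Local Notation X := (circle R * Y)%type.
Local Notation U := (PF_cover V eps).
Local Notation g := (PF hN S Sinv h eps).
Local Notation ghat := (PF_lift hN S Sinv h eps).
Implicit Types (i j k : J) (x : X).

Let hNS := hN_S hilF polH fockF hNP SP.
Let hND := hN_add hilF fockF hNP.
Let hNSinv := hN_Sinv hilF polH fockF hNP SP.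
Let hNU := hN_unitary hNP.
Let SU : unitary dotF S. Proof. by case: SP. Qed.
Let SK : cancel S Sinv. Proof. by case: SP => _ []. Qed.
Let SinvK : cancel Sinv S. Proof. by case: SP => _ []. Qed.
Let SinvU : unitary dotF Sinv. Proof. exact: unitary_inv SU SK SinvK. Qed.

Let S_hN z v : S (hN z v) = (cval z)^-1 *: hN z (S v).
Proof. by rewrite hNS scalerA mulVf ?cval_neq0// scale1r. Qed.

(** Away from the arc around 1 only the cocycle relation of [h] enters; over that arc, the scalar is
    the price of moving [S] or its inverse past the powers h^N. *)
Lemma PF_lift_mul i j k x v : U i x -> U j x -> U k x ->
  ghat i j x (ghat j k x v) =
  cval (- (PF_transition h j k x *~ (PF_winding eps i j x : int)) +
    (PF_gauge eps h j k x - PF_gauge eps h i k x + PF_gauge eps h i j x)) *: ghat i k x v.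
Proof.
rewrite !PF_coverE => -[_ vi] [_ vj] [_ vk].
have := h_trans vi vj vk.
rewrite /PF_lift /PF_transition /PF_winding /PF_gauge /winding /PF_transition.
rewrite -/(near1 eps x.1); case: i j k {vi vj vk} => [i|i] [j|j] [k|k] /=;
  set p := h i j x.2; set q := h j k x.2 => ->; case: (near1 eps x.1) => /=;
  rewrite ?(mulr1z, mulrN1z, mulr0z, subr0, sub0r, subrr, oppr0, opprK, addr0, add0r,
    addNr, SinvK, scale1r, hND, cval0)//.
(* The four remaining cases lie over the arc around 1; the sheets of i, j, k are in turn + - -, then
   - + +, then - + -, then - - +. *)
- by rewrite S_hN (linZ (hN p)).
- by rewrite (_ : q + _ = 0) ?cval0 ?scale1r//; zmod_eq.
- by rewrite -[q *+ _]/q -!hND hNS (linZ Sinv) SK [q + p]addrC.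
- by rewrite hNSinv (_ : q - _ = - p)//; zmod_eq.
Qed.

Lemma PF_lift_unitary i j x : unitary dotF (ghat i j x).
Proof.
rewrite /PF_lift; case: i j => [i|i] [j|j]; try exact: hNU.
  by case: ifP => _; [exact: unitary_comp (hNU _) SU|exact: hNU].
by case: ifP => _; [exact: unitary_comp SinvU (hNU _)|exact: hNU].
Qed.

Lemma PF_lift_continuous i j v x : U i x -> U j x ->
  {for x, continuous (fun x => ghat i j x v)}.
Proof.
move=> Ui Uj; have tc : {for x, continuous (PF_transition h i j)}.
  move: Ui Uj; rewrite !PF_coverE => -[/= _ vi] [/= _ vj].
  by apply: continuous_comp_at; [exact: continuous_snd|exact: h_cont].
have hc w : {for x, continuous (fun x => hN (PF_transition h i j x) w)}.
  apply: (@continuous_comp_at _ _ _ _ (fun z => hN z w)) => //.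
  exact: (hN_continuous hilF fockF hNP).
move: Ui Uj; rewrite !PF_coverE => -[/= si _] [/= sj _].
have n1 : side i != side j -> \forall y \near x, near1 eps y.1 = near1 eps x.1.
  case: (side i) si => si; case: (side j) sj => sj // _.
    exact: (continuous_fst (near1_near eps_gt0 eps_small sj si)).
  exact: (continuous_fst (near1_near eps_gt0 eps_small si sj)).
case: i j hc {tc si sj} n1 => [i|i] [j|j] hc n1; [exact: hc| | |exact: hc].
- case: (boolP (near1 eps x.1)) => x1.
    apply: continuous_near (hc (S v)); near=> y.
    have y1 : near1 eps y.1 = near1 eps x.1 by near: y; exact: n1.
    by rewrite /PF_lift -/(near1 eps y.1) y1 x1.
  apply: continuous_near (hc v); near=> y.
  have y1 : near1 eps y.1 = near1 eps x.1 by near: y; exact: n1.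
  by rewrite /PF_lift -/(near1 eps y.1) y1 (negPf x1).
case: (boolP (near1 eps x.1)) => x1.
  apply: (@continuous_near _ _ (fun y => Sinv (hN (h i j y.2) v))).
    near=> y; have y1 : near1 eps y.1 = near1 eps x.1 by near: y; exact: n1.
    by rewrite /PF_lift -/(near1 eps y.1) y1 x1.
  apply: (@continuous_comp_at _ _ _ _ Sinv); first exact: hc.
  exact: (unitary_continuous hilF SinvU).
apply: continuous_near (hc v); near=> y.
have y1 : near1 eps y.1 = near1 eps x.1 by near: y; exact: n1.
by rewrite /PF_lift -/(near1 eps y.1) y1 (negPf x1).
Unshelve. all: by end_near. Qed.

Lemma PF_unitary_lift : unitary_lift dotF U g ghat.
Proof.
split=> [i j x _ _|i j v]; first by split; [exact: PF_lift_unitary|].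
rewrite continuous_open_subspace; last by apply: openI; exact: PF_cover_open.
by move=> x /[!inE] -[Ui Uj]; exact: PF_lift_continuous.
Qed.

Lemma PF_dixmier_douady_cocycle : dixmier_douady_cocycle U ghat (PF_cocycle eps h).
Proof.
split; first exact: PF_cocycle_is_cocycle.
by move=> s x v Ux; rewrite PF_lift_mul ?PF_cocycleE.
Qed.

Lemma PF_PU_cocycle : PU_cocycle U g.
Proof.
move=> i j k x Ui Uj Uk W W' [z Wz] [z' Wz'].
have [W_lin _ _] := PF_lift_unitary i j x.
have W0 : ghat i j x 0 = 0.
  by have := W_lin (-1) 0 0; rewrite scaler0 add0r scaleN1r addNr.
(* The phases of the two representatives add up; the term left open is the scalar of
   [PF_lift_mul]. *)
eexists (z + z' + _) => v /=.
rewrite Wz Wz' -[cval z' *: _]addr0 W_lin W0 addr0 PF_lift_mul// !scalerA.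
by rewrite -!cvalD.
Qed.

End ProjectiveFockBundle.

(** * The image under the connecting homomorphism *)

Section ConnectingClass.
Variables (R : realType) (eps : R) (eps_gt0 : 0 < eps) (eps_small : eps < pi / 2).
Variables (Y : topologicalType) (n : nat) (V : 'I_n -> set Y).
Hypothesis coverV : open_cover V.
Variable h : 'I_n -> 'I_n -> Y -> circle R.
Hypothesis h_trans : forall i j k y, V i y -> V j y -> V k y ->
  h i k y = h i j y + h j k y.
Hypothesis h_cont : forall i j y, V i y -> V j y -> {for y, continuous (h i j)}.
Local Notation J := ('I_n + 'I_n)%type.
Local Notation X := (circle R * Y)%type.
Local Notation U := (PF_cover V eps).
Local Notation A := (winding_cover eps).
Local Notation w := (winding_cochain eps).

Let oV : forall i, open (V i) := coverV.1.

(** The sheet depends on the first coordinate alone and the chart on the second alone, so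
    restriction along this index function turns the winding and the transition functions into
    pullbacks from the factors. *)
Definition PF_index (r : Y -> 'I_n) (z : X) : J :=
  if sheet_of eps z.1 then inr (r z.2) else inl (r z.2).

Lemma side_PF_index r z : side (PF_index r z) = sheet_of eps z.1.
Proof. by rewrite /PF_index; case: ifP. Qed.

Lemma base_PF_index r z : base (PF_index r z) = r z.2.
Proof. by rewrite /PF_index; case: ifP. Qed.

Lemma PF_index_cover r z : V (r z.2) z.2 -> U (PF_index r z) z.
Proof.
by move=> Vr; rewrite PF_coverE side_PF_index base_PF_index; split=> //; exact: sheet_ofP.
Qed.

Lemma PF_open_cover : open_cover U.
Proof.
split=> [i|z]; first exact: PF_cover_open.
by have [i Vi] := coverV.2 z.2; exists (PF_index (fun=> i) z); exact: PF_index_cover.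
Qed.

Lemma pull_winding r s z :
  pair_cochain (@PF_winding _ eps Y n) (PF_index r \o s) z = pull_cochain fst w s z.
Proof. by rewrite /pair_cochain /PF_winding /= !side_PF_index. Qed.

Lemma pull_transition r s z :
  pair_cochain (PF_transition h) (PF_index r \o s) z =
  pull_cochain snd (fun s => pair_cochain h (r \o s)) s z.
Proof. by rewrite /pair_cochain /PF_transition /= !base_PF_index. Qed.

Lemma PF_connecting (beta : cech Y Zd 2) :
  connecting (cech_class V (pair_cochain h)) beta ->
  connecting (cech_class U (PF_cocycle eps h))
    (cup (cech_pull fst (pointed_class A w)) (cech_pull snd beta)).
Proof.
move=> [W [phi [m [[pW cphi ce cm] [phim hx ->]]]]].
set e := fun s z => expi (2 * pi * phi s z) in ce hx.
have cfst : continuous (fst : X -> circle R) by move=> z; exact: continuous_fst.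
have csnd : continuous (snd : X -> Y) by move=> z; exact: continuous_snd.
have pA : pointed_cover A := winding_cover_pointed eps_gt0 eps_small.
have cw : is_cocycle A w := winding_is_cocycle eps_gt0 eps_small.
move: hx; rewrite /cech_class; case: pselect => // cV; set r := fun x => projT1 _.
have Vr y : V (r y) y := projT2 (cid (cV.2 y)).
have pVr : pointed_cover (V \o r) by move=> y; split; [exact: oV|exact: Vr].
have ch : is_cocycle V (pair_cochain h).
  split.
    apply/is_cochainP => // s y Vy.
    by apply: h_cont; [exact: (Vy ord0)|exact: (Vy ord_max)].
  move=> s y Vy; rewrite cobound_pair.
  rewrite (h_trans (Vy ord0) (Vy (inord 1)) (Vy ord_max)); zmod_eq.
have chr : is_cocycle (V \o r) (fun s => pair_cochain h (r \o s)).
  by apply: (is_cocycle_comp (r := r)) ch => y z.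
move=> /(pointed_classP pVr chr pW ce)[W1 [pW1 W1V W1W he]].
case: pselect => [cU|[]]; last exact: PF_open_cover.
set rU := fun z => projT1 _.
have UrU z : U (rU z) z := projT2 (cid (cU.2 z)).
have cPF := PF_cocycle_is_cocycle eps_gt0 eps_small oV h_trans h_cont.
(* The index function picked by [cech_class] on the product cover is unrelated to [r]; [PF_index r]
   gives the same class. *)
rewrite (pointed_class_refine2 cU.1 cPF UrU (fun z => PF_index_cover (Vr z.2))).
rewrite (cech_pull_pointed cfst pA cw) (cech_pull_pointed csnd pW cm).
have pA' := pull_cover_pointed cfst pA; have cw' := is_cocycle_pull cfst pA cw.
have pW' := pull_cover_pointed csnd pW; have cm' := is_cocycle_pull csnd pW cm.
rewrite (cup_pointed pA' cw' pW' cm').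
set w' := pull_cochain fst w in cw' *.
set M := meet_cover _ _; have pM : pointed_cover M := meet_pointed pA' pW'.
have oM := pointed_cover_open pM.
have subA (B : topologicalZmodType) q (c : cochain X B X q) :
    is_cocycle (pull_cover fst A) c -> is_cocycle M c.
  by apply: (is_cocycle_comp (r := id)) => z x [].
have subW (B : topologicalZmodType) q (c : cochain X B X q) :
    is_cocycle (pull_cover snd W) c -> is_cocycle M c.
  by apply: (is_cocycle_comp (r := id)) => z x [].
(* The minus sign cancels that of [cobound_cup1], so the coboundary of this logarithm is the product
   of the winding cochain with [m], sign included. *)
pose phi' : cochain X R X 2 := fun s z => - cup1 w' (pull_cochain snd phi) s z.
have eE : (fun s z => expi (2 * pi * phi' s z)) =
    (fun s z => - cup1 w' (pull_cochain snd e) s z).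
  apply/funext => s; apply/funext => z.
  by rewrite /phi' /cup1 mulrN expiN mulrzAr expiMz.
have ce' : is_cocycle M (fun s z => - cup1 w' (pull_cochain snd e) s z).
  apply/is_cocycleN/is_cocycle_cup1 => //; [exact: subA|].
  exact/subW/is_cocycle_pull.
exists M, phi', (cup1 w' (pull_cochain snd m)); rewrite eE; split; split=> //.
- apply/is_cochainN/is_cochain_cup1 => //; first exact: (subA _ _ _ cw').1.
  apply: (is_cochain_comp (r := id)) (is_cochain_pull csnd pW cphi) => z x [_].
  exact.
- by apply: is_cocycle_cup1 => //; [exact: subA|exact: subW].
- move=> s z Mz; rewrite coboundN (cobound_cup1 _ (subA _ _ _ cw') Mz) opprK.
  rewrite /cup1 Zd_mulrz [RHS]mulrzA; congr (_ *~ _).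
  by apply: phim => k; have [_] := Mz (lift ord0 k).
apply/pointed_classP => //.
- by move=> z; split; [exact: PF_cover_open|exact/PF_index_cover/Vr].
- by apply: (is_cocycle_comp (r := PF_index r)) cPF => z x.
(* [W1] is where [h] and the exponential of [phi] become cohomologous on [Y]; pulled back and cut by
   the sheets, it refines both covers to be compared. *)
exists (meet_cover (pull_cover fst A) (pull_cover snd W1)); split.
- exact: meet_pointed (pull_cover_pointed csnd pW1).
- move=> z x [/= Az W1z]; rewrite PF_coverE side_PF_index base_PF_index; split=> //.
  exact: W1V.
- by move=> z x [/= Az W1z]; split=> //; exact: W1W.
set M1 := meet_cover _ _.
have pM1 : pointed_cover M1 := meet_pointed pA' (pull_cover_pointed csnd pW1).
(* With w the winding cochain, the difference of the two cocycles is - w (h - e) plus the coboundary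
   of the gauge. The first term is a coboundary because h - e is one and w is a cocycle. *)
have cup_cob : is_coboundary M1 (cup1 w' (fun s z =>
    pull_cochain snd (fun s => pair_cochain h (r \o s)) s z - pull_cochain snd e s z)).
  apply: is_coboundary_cup1r; first exact: pointed_cover_open.
    by apply: (is_cocycle_comp (r := id)) cw' => z x [].
  by apply: is_coboundaryW (is_coboundary_pull csnd pW1 he) => // z x [].
have gauge_cob : is_coboundary M1
    (fun s z => cobound (pair_cochain (PF_gauge eps h)) (PF_index r \o s) z).
  exists (fun s => pair_cochain (PF_gauge eps h) (PF_index r \o s)); split=> //.
  apply: (is_cochain_comp (r := PF_index r))
    (PF_gauge_is_cochain eps_gt0 eps_small oV h_trans h_cont).
  move=> z x [/= Az W1z]; rewrite PF_coverE side_PF_index base_PF_index; split=> //.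
  exact: W1V.
apply: is_coboundaryW (is_coboundaryD (is_coboundaryN cup_cob) gauge_cob) => [x z //|s z _].
rewrite /PF_cocycle /cup1 mulrzBl.
rewrite (_ : pair_cochain (PF_transition h) _ z = pull_cochain snd
  (fun s => pair_cochain h (r \o s)) (s \o lift ord0) z); last exact: pull_transition.
rewrite (_ : pair_cochain (@PF_winding _ eps Y n) _ z = w' (edge s) z); last first.
  exact: (pull_winding r).
set t1 := cobound _ _ _; set t2 := _ *~ w' _ _; set t3 := pull_cochain snd e _ _ *~ _.
zmod_eq.
Qed.

End ConnectingClass.

Theorem mainTheorem1 (R : realType)
    (H F : completeNormedModType (Cx R))
    (dotH : {dot H for Num.conj}) (dotF : {dot F for Num.conj})
    (hilbertH : hilbert dotH) (hilbertF : hilbert dotF)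
    (u : int -> H) (Hp Hm : set H) (polH : polarization dotH u Hp Hm)
    (a astar : H -> {linear F -> F}) (vac : F)
    (fockF : fock_space dotH dotF u Hp Hm a astar vac)
    (hN : circle R -> {linear F -> F})
    (hNP : charge_power dotF u a astar vac hN)
    (S Sinv : {linear F -> F})
    (SP : fock_shift dotF u a astar vac S Sinv)
    (Y : topologicalType) (compactY : compact [set: Y])
    (L : line_family R Y) (lineL : is_line_bundle L)
    (nontrivialL : ~ trivial_bundle L)
    (n : nat) (V : 'I_n -> set Y) (coverV : open_cover V)
    (phi : 'I_n -> Y * Cx R -> lb_total L) (psi : 'I_n -> lb_total L -> Cx R)
    (trivL : forall i, trivialization (V i) (phi i) (psi i))
    (h : 'I_n -> 'I_n -> Y -> circle R)
    (transL : transition_functions V phi h)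
    (eps : R) (eps_gt0 : 0 < eps) (eps_small : eps < pi / 2) :
  let U := PF_cover V eps in
  let g := PF hN S Sinv h eps in
  let ghat := PF_lift hN S Sinv h eps in
  exists alpha : cech (circle R) Zd 1, generates alpha /\
  exists f : cochain (circle R * Y)%type (circle R) ('I_n + 'I_n) 2,
    [/\ PU_cocycle U g, unitary_lift dotF U g ghat,
        dixmier_douady_cocycle U ghat f &
        forall beta : cech Y Zd 2,
          connecting (cech_class V (pair_cochain h)) beta ->
          connecting (cech_class U f)
            (cup (cech_pull fst alpha) (cech_pull snd beta))].
Proof.
move=> U g ghat.
have oV := coverV.1.
have h_trans := transition_fun_trans trivL transL.
have h_cont := transition_fun_continuous lineL oV trivL transL.
exists (pointed_class (winding_cover eps) (winding_cochain eps)); split.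
  exact: winding_generates.
exists (PF_cocycle eps h); split.
- exact: (PF_PU_cocycle hilbertF polH fockF hNP SP h_trans).
- exact: (PF_unitary_lift eps_gt0 eps_small hilbertF fockF hNP SP oV h_cont).
- exact: (PF_dixmier_douady_cocycle eps_gt0 eps_small hilbertF polH fockF hNP SP oV
    h_trans h_cont).
- by move=> beta; exact: PF_connecting.
Qed.
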